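(* Let $\ell\ge 1$ and, for $1\le i\le \ell$, let $F_i$ be a finite simple connected regular graph of positive valency $d_i$, with a vertex $r_i$ such that the distance partition of $F_i$ at $r_i$ is equitable. Put $G=F_1\square\cdots\square F_\ell$ and $a=(r_1,\ldots,r_\ell)$. Let $\Theta_i,\omega_i,\Phi_i,\eta_i$ be the local spectral data of $(F_i,r_i)$, let $I_1,\ldots,I_t$ be the boundary classes, and let $c_g$ ($1\le g\le t$), $T_g$ and $\Lambda=T_1+\cdots+T_t$ be as defined in the context. Let $V=\big(\bigotimes_{i=1}^{\ell} W(F_i,r_i)\big)\cap e_a^{\perp}$, regarded as a subspace of $\mathbb R^{V(G)\setminus\{a\}}$. Then the boundary-return space $\mathcal C$ of $V$ is exactly $$\mathcal C=\operatorname{span}\{c_1,\ldots,c_t\}.$$ For $\lambda\in\Lambda$, let $R_\lambda$ be the matrix with one row $$(1,y_1,\ldots,y_t)\quad\text{for each } y=(y_1,\ldots,y_t)\in T_1\times\cdots\times T_t \text{ with } \sum_{g=1}^t y_g=\lambda .$$ Then $$\dim P_a(G)=\sum_{\lambda\in\Lambda}\operatorname{rank} R_\lambda-1 .$$ In particular, $\dim P_a(G)$ is determined by the rooted local spectral measures $(\Theta_i,\omega_i)$, $1\le i\le \ell$, of the factors.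
   Context: All graphs are finite and simple; all algebras and vector spaces are over $\mathbb R$; vertex spaces carry the usual Euclidean inner product; $A(\cdot)$ denotes the adjacency matrix; $e_v$ is the standard basis vector of a vertex $v$; $\square$ is the Cartesian product of graphs. For a connected regular graph $G$ with at least two vertices and $a\in V(G)$: $N(a)$ is the set of neighbours of $a$, $B=A(G-a)$, $b=\mathbf 1_{N(a)}\in\mathbb R^{V(G)\setminus\{a\}}$ is the indicator vector of $N(a)$, $E$ is the diagonal matrix with diagonal $\mathbf 1_{N(a)}$ (indexed by $V(G)\setminus\{a\}$), and $\mathbf 1$ is the all-ones vector on $V(G)\setminus\{a\}$. $\mathcal B_a=\langle I,B,E\rangle$ is the real unital matrix algebra generated by $B$ and $E$, and $P_a=P_a(G)=\mathcal B_a\mathbf 1$. Vectors on $V(G)\setminus\{a\}$ are identified with their extensions by zero at $a$. Boundary-return space: for a $B,E$-invariant subspace $V\subseteq\mathbb R^{V(G)\setminus\{a\}}$ containing $\mathbf 1$, put $\mathcal L=EV$ and $H_k=EB^kE|_{\mathcal L}$ ($k\ge0$). The boundary-return space $\mathcal C\subseteq\mathcal L$ of $V$ is the smallest subspace containing $b$ and invariant under all $H_k$, $k\ge 0$. For a rooted graph $(F,r)$, the distance partition at $r$ is the partition of $V(F)$ into the spheres $S_j(r)=\{v: \operatorname{dist}(r,v)=j\}$, $0\le j\le \max_v \operatorname{dist}(r,v)$; it is equitable if the number of neighbours of a vertex $v$ in a given cell depends only on the cell containing $v$. $W(F,r)=\mathbb R[A(F)]e_r$. Local spectral data of a rooted regular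 graph $(F,r)$ of valency $d>0$: $E_\theta$ is the orthogonal projection onto the $\theta$-eigenspace of $A(F)$; $\Theta=\{\theta:E_\theta e_r\ne0\}$; $\omega(\theta)=\|E_\theta e_r\|^2$ for $\theta\in\Theta$; $\Phi(z)=\sum_{\theta\in\Theta}\omega(\theta)e^{z\theta}$; $\eta(z)=\frac1d\,\Phi'(z)/\Phi(z)$ for real $z$ ($\Phi>0$ on $\mathbb R$). In the product: $b_i$ is the indicator vector of those neighbours of $a$ obtained by changing only the $i$th coordinate. The boundary classes $I_1,\ldots,I_t$ are the equivalence classes on $\{1,\ldots,\ell\}$ of the relation $i\sim j\iff \eta_i(z)=\eta_j(z)$ for all real $z$. For each class, $c_g=\sum_{i\in I_g}b_i$ and $T_g=\sum_{i\in I_g}\Theta_i$ (sum of finite subsets of $\mathbb R$: $X+Y=\{x+y:x\in X,y\in Y\}$). The tensor product $\bigotimes_i W(F_i,r_i)$ is regarded as a subspace of $\mathbb R^{V(G)}=\bigotimes_i\mathbb R^{V(F_i)}$; the space $V$ in the claim is $B,E$-invariant and contains $\mathbf 1$. *)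

(* Defs.v *)
From HB Require Import structures.
From mathcomp Require Import all_boot all_order all_algebra.
From mathcomp Require finmap.
From mathcomp Require Import all_classical all_reals all_analysis.

Set Implicit Arguments.
Unset Strict Implicit.
Unset Printing Implicit Defensive.

Import Order.TTheory GRing.Theory Num.Theory.
Import numFieldNormedType.Exports.
Local Open Scope ring_scope.

(* Rooted graphs: a finite vertex type with a boolean edge relation. *)

Definition simple_graph (T : finType) (e : rel T) : Prop :=
  symmetric e /\ irreflexive e.

Definition connected_graph (T : finType) (e : rel T) : Prop :=
  forall x y : T, connect e x y.

Definition regular_graph (T : finType) (e : rel T) (d : nat) : Prop :=
  forall x : T, #|[set y | e x y]| = d.

Definition walk (T : finType) (e : rel T) (n : nat) (x y : T) : bool :=
  [exists p : n.-tuple T, path e x p && (last x p == y)].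

(* Length of a shortest walk from x to y; it is #|T| when there is none. *)
Definition gdist (T : finType) (e : rel T) (x y : T) : nat :=
  find (fun n => walk e n x y) (iota 0 #|T|).

Definition equitable (T : finType) (e : rel T) (P : {set {set T}}) : Prop :=
  forall C D : {set T}, C \in P -> D \in P ->
  forall u v : T, u \in C -> v \in C ->
    #|[set w in D | e u w]| = #|[set w in D | e v w]|.

Definition distance_partition (T : finType) (e : rel T) (r : T)
  : {set {set T}} := preim_partition (gdist e r) [set: T].

Definition admissible_factor (T : finType) (e : rel T) (r : T) (d : nat)
  : Prop :=
  [/\ simple_graph e, connected_graph e, regular_graph e d, (0 < d)%N
    & equitable e (distance_partition e r)].

Local Open Scope classical_set_scope.

Section SmallestSubspace.
Variables (K : fieldType) (vT : vectType K).

(* The least subspace satisfying P, and the junk value 0 if there is none;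
   smallest_vsP covers the uses below (for boundary_return_space, when V is
   invariant and contains the all-ones vector). *)
Definition smallest_vs (P : set {vspace vT}) : {vspace vT} :=
  xget 0%VS [set U | P U /\ forall W, P W -> (U <= W)%VS].

Lemma smallest_vsP (P : set {vspace vT}) :
    (exists U, P U) -> (forall U W, P U -> P W -> P (U :&: W)%VS) ->
  P (smallest_vs P) /\ forall W, P W -> (smallest_vs P <= W)%VS.
Proof.
move=> exP capP; rewrite /smallest_vs.
apply: (@xgetPex _ 0%VS [set U | P U /\ forall W, P W -> (U <= W)%VS]).
have exn : exists n, `[< exists2 U, P U & \dim U = n >].
  by have [U PU] := exP; exists (\dim U); apply/asboolP; exists U.
have [n /asboolP[U PU dU] min_n] := ex_minnP exn; exists U; split=> // W PW.
apply/capv_idPl/eqP; rewrite eqEdim capvSl /= dU; apply: min_n.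
by apply/asboolP; exists (U :&: W)%VS => //; apply: capP.
Qed.

Definition span_set (S : set vT) : {vspace vT} :=
  smallest_vs [set U | forall v, S v -> v \in U].

End SmallestSubspace.

Section VertexSpace.
Variable R : realType.

(* The vertex space of T is 'cV[R]_#|T|, indexed through the enumeration of T;
   vfun f has coordinate f x at the vertex x. *)
Definition vfun (T : finType) (f : T -> R) : 'cV[R]_#|T| :=
  \col_k f (enum_val k).

Definition coord_at (T : finType) (v : 'cV[R]_#|T|) (x : T) : R :=
  v (enum_rank x) 0.

Definition basis_vec (T : finType) (x : T) : 'cV[R]_#|T| :=
  vfun (fun y => (y == x)%:R).

Definition adjmx (T : finType) (e : rel T) : 'M[R]_#|T| :=
  \matrix_(i, j) (e (enum_val i) (enum_val j))%:R.

Definition orth_vec (n : nat) (v : 'cV[R]_n) : {vspace 'cV[R]_n} :=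
  lker (linfun (mulmx v^T)).

End VertexSpace.

Section Punctured.
Variables (R : realType) (T : finType) (e : rel T) (a : T).

(* The vertex set of G - a. *)
Definition punctured : finType := {x : T | x != a}.

Definition adj_punctured : 'M[R]_#|punctured| :=
  adjmx R (fun x y : punctured => e (val x) (val y)).

Definition nbr_vec : 'cV[R]_#|punctured| :=
  vfun (fun x : punctured => (e a (val x))%:R).

Definition nbr_diag : 'M[R]_#|punctured| := diag_mx nbr_vec^T.

Definition ones_vec : 'cV[R]_#|punctured| := const_mx 1.

Definition local_algebra : {vspace 'M[R]_#|punctured|} :=
  smallest_vs [set U : {vspace 'M[R]_#|punctured|} |
    [/\ 1%:M \in U, adj_punctured \in U, nbr_diag \in U
      & forall M N : 'M[R]_#|punctured|, M \in U -> N \in U -> M *m N \in U]].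

Definition local_module : {vspace 'cV[R]_#|punctured|} :=
  (linfun (mulmxr ones_vec) @: local_algebra)%VS.

Definition boundary_space (V : {vspace 'cV[R]_#|punctured|})
  : {vspace 'cV[R]_#|punctured|} := (linfun (mulmx nbr_diag) @: V)%VS.

Definition return_mx (k : nat) : 'M[R]_#|punctured| :=
  nbr_diag *m adj_punctured ^+ k *m nbr_diag.

Definition boundary_return_space (V : {vspace 'cV[R]_#|punctured|})
  : {vspace 'cV[R]_#|punctured|} :=
  smallest_vs [set C : {vspace 'cV[R]_#|punctured|} |
    [/\ (C <= boundary_space V)%VS, nbr_vec \in C
      & forall (k : nat) (v : 'cV[R]_#|punctured|),
          v \in C -> return_mx k *m v \in C]].

(* Forgets the coordinate at a: the identification of the vectors vanishing
   at a with the vectors on V(G) \ {a}. *)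
Definition forget_root (v : 'cV[R]_#|T|) : 'cV[R]_#|punctured| :=
  rowsub (fun k => enum_rank (val (enum_val k))) v.

Fact forget_root_is_linear : linear forget_root.
Proof. exact: linearP. Qed.

HB.instance Definition _ :=
  GRing.isLinear.Build R 'cV[R]_#|T| 'cV[R]_#|punctured| _ forget_root
    forget_root_is_linear.

End Punctured.

Section LocalSpectrum.
Variables (R : realType) (T : finType) (e : rel T) (r : T).

(* Krylov space R[A] e_r. *)
Definition krylov : {vspace 'cV[R]_#|T|} :=
  span_set [set v | exists k : nat, v = adjmx R e ^+ k *m basis_vec R r].

(* Orthogonal projection onto the theta-eigenspace: kermx U^T is the orthogonal
   complement of the row space of U.  Library eigenspaces consist of row
   vectors, but both the adjacency matrix and the projection are symmetric. *)
Definition eigenproj (theta : R) : 'M[R]_#|T| :=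
  let U := eigenspace (adjmx R e) theta in proj_mx U (kermx U^T).

Definition local_spectrum : set R :=
  [set theta | eigenproj theta *m basis_vec R r != 0].

Definition local_weight (theta : R) : R :=
  let u := eigenproj theta *m basis_vec R r in (u^T *m u) 0 0.

Definition local_Phi (z : R) : R :=
  \sum_(theta \in local_spectrum) local_weight theta * expR (z * theta).

Definition local_eta (d : nat) (z : R) : R :=
  d%:R^-1 * (derive1 local_Phi z / local_Phi z).

End LocalSpectrum.

Arguments local_spectrum R {T} e r _.
Arguments local_weight R {T} e r theta.
Arguments local_eta R {T} e r d z.

Definition minkowski_add (R : realType) (X Y : set R) : set R :=
  [set x + y | x in X & y in Y].

Definition minkowski_sum (R : realType) (J : finType) (A : {set J})
  (X : J -> set R) : set R :=
  \big[@minkowski_add R/[set 0]]_(i in A) X i.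

Section CartesianProduct.
Variables (R : realType) (l : nat) (F : 'I_l -> finType).
Variables (e : forall i, rel (F i)) (r : forall i, F i) (d : 'I_l -> nat).

Definition box_vertex : finType := {dffun forall i : 'I_l, F i}.

Definition box_step (i : 'I_l) (x y : box_vertex) : bool :=
  e (x i) (y i) && [forall j : 'I_l, (j != i) ==> (x j == y j)].

Definition box_edge : rel box_vertex :=
  fun x y => [exists i, box_step i x y].

Definition box_root : box_vertex := [ffun i => r i].

Definition pure_tensor (w : forall i, 'cV[R]_#|F i|) : 'cV[R]_#|box_vertex| :=
  vfun (fun x : box_vertex => \prod_(i < l) coord_at (w i) (x i)).

Definition krylov_tensor : {vspace 'cV[R]_#|box_vertex|} :=
  span_set [set v | exists2 w : forall i, 'cV[R]_#|F i|,
    (forall i, w i \in krylov R (@e i) (r i)) & v = pure_tensor w].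

Definition krylov_punctured : {vspace 'cV[R]_#|punctured box_root|} :=
  (linfun (@forget_root R box_vertex box_root) @:
     (krylov_tensor :&: orth_vec (basis_vec R box_root)))%VS.

(* b_i *)
Definition dir_vec (i : 'I_l) : 'cV[R]_#|punctured box_root| :=
  vfun (fun x : punctured box_root => (box_step i box_root (val x))%:R).

Definition boundary_classes : {set {set 'I_l}} :=
  equivalence_partition
    (fun i j : 'I_l =>
       `[< forall z : R, local_eta R (@e i) (r i) (d i) z
                         = local_eta R (@e j) (r j) (d j) z >])
    [set: 'I_l]%SET.

(* c_g and T_g, for the class I_g *)
Definition class_vec (I_g : {set 'I_l}) : 'cV[R]_#|punctured box_root| :=
  \sum_(i in I_g) dir_vec i.

Definition class_spectrum (I_g : {set 'I_l}) : set R :=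
  minkowski_sum I_g (fun i => local_spectrum R (@e i) (r i)).

End CartesianProduct.

Arguments class_spectrum R {l F} e r I_g _.

Section RowMatrix.
Variables (R : realType) (t : nat) (X : 'I_t -> set R) (lam : R).

(* The y in X_1 x ... x X_t with coordinate sum lam (a finite set when the X_g
   are finite), listed without repetition in some order. *)
Definition fiber : set 'rV[R]_t :=
  [set y | (forall g, X g (y 0 g)) /\ \sum_(g < t) y 0 g = lam].

Definition fiber_seq : seq 'rV[R]_t := finmap.enum_fset (fset_set fiber).

Definition fiber_mx : 'M[R]_(size fiber_seq, 1 + t) :=
  \matrix_(k < size fiber_seq) row_mx (1%:M : 'M[R]_1) (nth 0 fiber_seq k).

End RowMatrix.

(* Main.v *)
Require Import Defs.
From HB Require Import structures.
From mathcomp Require Import all_boot all_order all_algebra.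
From mathcomp Require Import all_classical all_reals all_analysis.
From mathcomp Require Import lra.

Set Implicit Arguments.
Unset Strict Implicit.
Unset Printing Implicit Defensive.

Import Order.TTheory GRing.Theory Num.Theory.
Import numFieldNormedType.Exports.
Local Open Scope classical_set_scope.
Local Open Scope ring_scope.

(** The root vector e_a is split along the commuting adjacency matrices A_i of
    the factors.  A labelling f picks one local eigenvalue th (f i) in each
    factor; the tensor product w_f of the corresponding components of the e_(r_i)
    ([joint_vec]) is a joint eigenvector, the w_f are pairwise orthogonal, and
    e_a = sum_f w_f, b_i = A_i e_a = sum_f th (f i) w_f.  The value of w_f at a is
    the weight wt f, the product of the local weights, so w_f vanishes exactly
    when wt f does.  Equitability is used once: a component of e_(r_i) is constant
    on the neighbours of r_i ([local_comp_nbr]), whence the part of w_f on N(a) is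
    sum_i wt f * (th (f i) / d_i) * b_i ([joint_vec_boundary]).

    Boundary-return space.  A walk returning to a leaves it again through b, so a
    space that contains b and is stable under the E B^k E is, on vectors supported
    in N(a), also stable under the E A^k E ([boundary_words]).  In the coordinates
    b_i the latter have entries
    (1 / d_i) sum_f wt f * th (f i) * th (f j) * lam^k, lam being the sum of the
    th (f i).  The coordinates of f are independent under wt, so the exponential
    generating function of these moments is, with Phi the product of the Phi_i,
      Phi * (d_j eta_i eta_j + delta_ij eta_i')
    ([return_term_expsum]).  The index i enters through eta_i only, so families of
    coefficients that are constant on the boundary classes stay so
    ([return_term_class]).  Conversely an invariant space with b in it contains
    the family eta_i(z), and then is stable under multiplication by eta_i'(z),
    for every z.  As eta_i(0) = 0, these derivatives separate exactly the boundary
    classes, and products of affine functions of them are the class indicators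
    ([class_indicator]).

    Dimension.  Let Q be the A-invariant space generated by e_a and the c_g
    ([root_space]).  Then P_a is Q with the coordinate at a forgotten
    ([local_module_punctured_space]), and what is lost is the line of e_a; this is
    the -1.  The all-ones vector is in the image of Q because D - B, with D the
    valency of G, is injective (a function harmonic off a that vanishes at a is 0)
    and maps the ones to b.  The lam-part of Q consists of the combinations
    sum_y (c_0 + sum_g c_g y_g) w_y over the rows (1, y) of R_lam, where w_y
    gathers the w_f whose class sums are y; the w_y are orthogonal and nonzero,
    so this part has dimension rank R_lam.

    Determination by local data.  The measures give the Phi_i, then
    d_i = Phi_i''(0), the eta_i, the classes and the T_g, hence every R_lam. *)

(** * Spectral theorem for real symmetric matrices *)

Section SymmetricSpectrum.
Variables (R : realType) (n : nat).
Implicit Types (u v w : 'rV[R]_n) (A : 'M[R]_n).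

Definition dot u v : R := (u *m v^T) 0 0.

Lemma dotE u v : dot u v = \sum_i u 0 i * v 0 i.
Proof. by rewrite /dot mxE; apply: eq_bigr => i _; rewrite mxE. Qed.

Lemma dotC u v : dot u v = dot v u.
Proof. by rewrite !dotE; apply: eq_bigr => i _; rewrite mulrC. Qed.

Lemma dotDl u v w : dot (u + v) w = dot u w + dot v w.
Proof. by rewrite /dot mulmxDl mxE. Qed.

Lemma dotZl (c : R) u v : dot (c *: u) v = c * dot u v.
Proof. by rewrite /dot -scalemxAl mxE. Qed.

Lemma dotDr u v w : dot u (v + w) = dot u v + dot u w.
Proof. by rewrite dotC dotDl !(dotC _ u). Qed.

Lemma dotZr (c : R) u v : dot u (c *: v) = c * dot u v.
Proof. by rewrite dotC dotZl dotC. Qed.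

Lemma dot_ge0 u : 0 <= dot u u.
Proof. by rewrite dotE sumr_ge0 // => i _; rewrite -expr2 sqr_ge0. Qed.

Lemma dot_eq0 u : (dot u u == 0) = (u == 0).
Proof.
apply/idP/eqP => [|->]; last by rewrite /dot mul0mx mxE.
rewrite dotE psumr_eq0 => [/allP u0|i _]; last by rewrite -expr2 sqr_ge0.
by apply/rowP => i; apply/eqP; have := u0 i (mem_index_enum i);
  rewrite mxE mulf_eq0 orbb.
Qed.

Lemma dot_sym A u v : A^T = A -> dot (u *m A) v = dot u (v *m A).
Proof. by move=> Asym; rewrite /dot trmx_mul Asym mulmxA. Qed.

Lemma dot_continuous (f g : 'rV[R]_n -> 'rV[R]_n) :
  (forall i, continuous (fun v => f v 0 i)) ->
  (forall i, continuous (fun v => g v 0 i)) ->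
  continuous (fun v => dot (f v) (g v)).
Proof.
move=> fc gc v.
rewrite (_ : (fun v => _) = (fun v => \sum_i f v 0 i * g v 0 i)); last first.
  by apply/funext => u; rewrite dotE.
have : forall (r : seq 'I_n),
   {for v, continuous (fun v => \sum_(i <- r) f v 0 i * g v 0 i)}.
  elim=> [|i r IHr].
    rewrite (_ : (fun v => _) = fun=> 0); first exact: cst_continuous.
    by apply/funext => u; rewrite big_nil.
  rewrite (_ : (fun v => _) =
    (fun v => f v 0 i * g v 0 i + \sum_(i <- r) f v 0 i * g v 0 i)); last first.
    by apply/funext => u; rewrite big_cons.
  by apply: continuousD IHr; apply: continuousM; [apply: fc|apply: gc].
exact.
Qed.

Lemma mulmx_coord_continuous A i : continuous (fun v => (v *m A) 0 i).
Proof.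
move=> v; rewrite (_ : (fun v => _) = (fun v => dot v (\row_j A j i))).
  apply: dot_continuous => j; first exact: coord_continuous.
  by move=> ?; apply: cst_continuous.
by apply/funext => u; rewrite dotE mxE; apply: eq_bigr => j _; rewrite mxE.
Qed.

(** The quadratic form of A attains its maximum x on the unit vectors orthogonal to
    U; a maximiser is an eigenvector because x - A is then positive semidefinite on
    the orthogonal complement of U, which A preserves. *)
Lemma symmetric_eigenvector_orth A (U : 'M[R]_n) :
  A^T = A -> (U *m A <= U)%MS -> (\rank U < n)%N ->
  exists v (x : R), [/\ v != 0, v *m U^T = 0 & v *m A = x *: v].
Proof.
move=> Asym UA ltUn.
pose K := [set v : 'rV[R]_n | dot v v = 1 /\ v *m U^T = 0].
have K0 : K !=set0.
  have : kermx U^T != 0.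
    by rewrite -mxrank_eq0 mxrank_ker mxrank_tr -lt0n subn_gt0.
  case/rowV0Pn => v /sub_kermxP vU v0.
  exists ((Num.sqrt (dot v v))^-1 *: v); split; last by rewrite -scalemxAl vU scaler0.
  have vv : 0 < dot v v by rewrite lt_def dot_ge0 dot_eq0 v0.
  rewrite dotZl dotC dotZl mulrA -expr2 exprVn sqr_sqrtr ?dot_ge0 //.
  by rewrite mulVf // gt_eqF.
have Kcompact : compact K.
  apply: bounded_closed_compact.
    exists 1; split; first exact: num_real.
    move=> M M1 v [v1 _]; apply: le_trans (ltW M1).
    rewrite /Num.norm /= mx_normrE.
    apply: bigmax_le => // -[i j] _ /=; rewrite ord1 -(@expr_le1 _ 2) //.
    rewrite -v1 dotE (bigD1 j) //= -expr2 real_normK ?num_real //.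
    by rewrite lerDl sumr_ge0 // => k _; rewrite -expr2 sqr_ge0.
  rewrite (_ : K = (fun v => dot v v) @^-1` [set 1] `&`
     (fun v => dot (v *m U^T) (v *m U^T)) @^-1` [set 0]); last first.
    apply/seteqP; split=> v /= [v1 vU]; split => //.
      by apply/eqP; rewrite dot_eq0 vU.
    by apply/eqP; rewrite -dot_eq0; apply/eqP.
  apply: closedI; apply: preimage_closed; try exact: closed_eq; move=> v _.
    by apply: dot_continuous => i; apply: coord_continuous.
  by apply: dot_continuous => i; apply: mulmx_coord_continuous.
have fc : {within K, continuous (fun v => dot (v *m A) v)}.
  apply: continuous_subspaceT => v; apply: dot_continuous => i.
    exact: mulmx_coord_continuous.
  exact: coord_continuous.
have [v /set_mem[vv vU] vmax] := compact_EVT_max K0 Kcompact fc.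
set x := dot (v *m A) v in vmax; exists v, x.
have vN0 : v != 0 by rewrite -dot_eq0 vv oner_eq0.
split=> //.
have psd u : u *m U^T = 0 -> 0 <= x * dot u u - dot (u *m A) u.
  move=> uU; have [->|u0] := eqVneq u 0.
    by rewrite mul0mx /dot !mul0mx mxE mulr0 subr0.
  have uu : 0 < dot u u by rewrite lt_def dot_ge0 dot_eq0 u0.
  set c := (Num.sqrt (dot u u))^-1.
  have cc : c * (c * dot u u) = 1.
    by rewrite mulrA -expr2 exprVn sqr_sqrtr ?dot_ge0 // mulVf // gt_eqF.
  have : dot ((c *: u) *m A) (c *: u) <= x.
    apply: vmax; apply/mem_set; split; last by rewrite -scalemxAl uU scaler0.
    by rewrite dotZl dotC dotZl.
  rewrite -scalemxAl dotZl dotC dotZl [dot u _]dotC => le_x.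
  have : 0 <= c * (c * (x * dot u u - dot (u *m A) u)).
    by rewrite !mulrBr -!(mulrCA x) cc mulr1 subr_ge0.
  have c0 : 0 < c by rewrite invr_gt0 sqrtr_gt0.
  by rewrite !pmulr_rge0.
(* The defect w of the eigenvalue equation is itself orthogonal to U. *)
have [w wE] : exists w, w = x *: v - v *m A by eexists.
have wU : w *m U^T = 0.
  have /submxP[M UAE] := UA.
  rewrite wE mulmxBl -scalemxAl vU scaler0 sub0r -mulmxA -{1}Asym -trmx_mul UAE.
  by rewrite trmx_mul mulmxA vU mul0mx oppr0.
(* Perturbing v by t w gives a nonnegative quadratic in t without constant term,
   so its linear coefficient 2 |w|^2 has to vanish. *)
have quad t : 0 <= 2 * t * dot w w + t ^+ 2 * (x * dot w w - dot (w *m A) w).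
  have := psd (v + t *: w); rewrite mulmxDl -!scalemxAl vU wU scaler0 addr0.
  move=> /(_ erefl); suff -> : x * dot (v + t *: w) (v + t *: w) -
      dot ((v + t *: w) *m A) (v + t *: w) = 2 * t * dot w w +
         t ^+ 2 * (x * dot w w - dot (w *m A) w) by [].
  have ww : dot w w = x * dot v w - dot (v *m A) w.
    by rewrite {1}wE dotDl dotZl -scaleN1r dotZl mulN1r.
  rewrite mulmxDl -scalemxAl !(dotDl, dotZl, dotDr, dotZr) -/x vv.
  by rewrite (dotC w v) (dot_sym w v Asym) (dotC w) ww; lra.
have := psd w wU; set b := _ - _ in quad * => b0.
suff : dot w w = 0.
  by move/eqP; rewrite dot_eq0 wE subr_eq0 => /eqP.
have b1 : 0 < b + 1 by lra.
have := dot_ge0 w; rewrite le_eqVlt => /predU1P[//|a0].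
have := quad (- (dot w w / (b + 1))); set c := _ / _.
have cb : c * b = dot w w - c by rewrite -(divfK (lt0r_neq0 b1) (dot w w)) -/c; lra.
have c0 : 0 < c by rewrite divr_gt0.
by rewrite expr2 mulrNN -(mulrA c c b) cb => q; nra.
Qed.

Lemma eigenspace_big_sup A (x : R) (rs : seq R) : x \in rs ->
  (eigenspace A x <= \sum_(y <- rs) eigenspace A y)%MS.
Proof. by move=> xrs; rewrite (big_rem x) //= addsmxSl. Qed.

(** As long as the eigenspaces found so far do not fill the space, their orthogonal
    complement contains a further eigenvector, so the rank grows. *)
Lemma symmetric_eigenspaces A : A^T = A ->
  exists2 rs, uniq rs & (1%:M <= \sum_(x <- rs) eigenspace A x)%MS.
Proof.
move=> Asym.
suff H k rs : uniq rs -> (n - \rank (\sum_(x <- rs) eigenspace A x) <= k)%N ->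
    exists2 rs, uniq rs & (1%:M <= \sum_(x <- rs) eigenspace A x)%MS.
  exact: (H n [::] isT (leq_subr _ _)).
elim: k rs => [|k IHk] rs urs; set U := (\sum_(x <- rs) _)%MS => ltk.
  by exists rs => //; rewrite sub1mx /row_full eqn_leq rank_leq_col -subn_eq0 -leqn0.
have [fullU|] := boolP (row_full U); first by exists rs => //; rewrite sub1mx.
move=> nfullU; have ltUn : (\rank U < n)%N by rewrite ltn_neqAle nfullU rank_leq_col.
have UA : (U *m A <= U)%MS.
  rewrite /U; elim: (rs) => [|y s IHs]; first by rewrite big_nil mul0mx sub0mx.
  rewrite big_cons addsmxMr addsmxS //.
  by have /eigenspaceP -> := submx_refl (eigenspace A y); rewrite scalemx_sub.
have [v [x [v0 vU vA]]] := symmetric_eigenvector_orth Asym UA ltUn.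
have vx : (v <= eigenspace A x)%MS by apply/eigenspaceP.
have vNU : ~~ (v <= U)%MS.
  apply: contra v0 => /submxP[c vE]; rewrite -dot_eq0 /dot {2}vE.
  by rewrite trmx_mul mulmxA vU mul0mx mxE.
apply: (IHk (x :: rs)) => /=.
  rewrite urs andbT; apply: contra vNU => xrs.
  exact: submx_trans vx (eigenspace_big_sup A xrs).
rewrite big_cons -/U -ltnS; apply: leq_trans ltk; apply: ltn_sub2l => //.
apply: rank_ltmx; rewrite ltmxE addsmxSr; apply: contra vNU.
by apply: submx_trans; apply: submx_trans vx _; apply: addsmxSl.
Qed.
End SymmetricSpectrum.

(** * Eigenprojections of a symmetric matrix *)

Lemma interpolation (K : fieldType) (s : seq K) (g : K -> K) :
  exists q : {poly K}, forall x, x \in s -> q.[x] = g x.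
Proof.
elim: s => [|x s [q qE]]; first by exists 0.
have [xs|xNs] := boolP (x \in s).
  by exists q => y; rewrite inE => /predU1P[->|]; apply: qE.
pose m := \prod_(y <- s) ('X - y%:P).
have mx0 : m.[x] != 0.
  by rewrite -rootE root_prod_XsubC.
exists (q + ((g x - q.[x]) / m.[x]) *: m) => y.
rewrite inE hornerD hornerZ => /predU1P[->|ys].
  by rewrite divfK // addrCA subrr addr0.
have /rootP -> : root m y by rewrite root_prod_XsubC.
by rewrite mulr0 addr0 qE.
Qed.

Section Eigenprojection.
Variables (R : realType) (n : nat) (A : 'M[R]_n).
Hypothesis Asym : A^T = A.

(** [proj_mx] projects onto the row space of its first argument along that of the
    second, here the orthogonal complement. *)
Definition orthproj (U : 'M[R]_n) : 'M[R]_n := proj_mx U (kermx U^T).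

Lemma cap_orth (U : 'M[R]_n) : (U :&: kermx U^T = 0)%MS.
Proof.
apply/eqP/rowV0P => v; rewrite sub_capmx => /andP[/submxP[c vE] /sub_kermxP vU].
by apply/eqP; rewrite -dot_eq0 /dot {2}vE trmx_mul mulmxA vU mul0mx mxE.
Qed.

Lemma add_orth (U : 'M[R]_n) : (1%:M <= U + kermx U^T)%MS.
Proof.
rewrite sub1mx /row_full -[X in X == _]addn0 -[X in (_ + X)%N](mxrank0 R n n).
by rewrite -(cap_orth U) mxrank_sum_cap mxrank_ker mxrank_tr subnKC ?rank_leq_col.
Qed.

Lemma orthproj_id (U : 'M[R]_n) m (W : 'M[R]_(m, n)) :
  (W <= U)%MS -> W *m orthproj U = W.
Proof. by apply: proj_mx_id; apply: cap_orth. Qed.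

Lemma orthproj_sub (U : 'M[R]_n) : (orthproj U <= U)%MS.
Proof. by rewrite -[orthproj U]mul1mx proj_mx_sub. Qed.

Lemma orthproj_sym (U : 'M[R]_n) : (orthproj U)^T = orthproj U.
Proof.
have compl : (1%:M - orthproj U) *m U^T = 0.
  by apply/sub_kermxP; have := proj_mx_compl_sub (add_orth U); rewrite mul1mx.
have [M PE] := submxP (orthproj_sub U).
have : (1%:M - orthproj U) *m (orthproj U)^T = 0.
  by rewrite {2}PE trmx_mul mulmxA compl mul0mx.
rewrite mulmxBl mul1mx => /eqP; rewrite subr_eq0 => /eqP PPt.
move: (orthproj U) PPt {M PE compl} => P PPt.
have PE : P = P *m P^T by have := congr1 trmx PPt; rewrite trmx_mul !trmxK.
by rewrite PPt -PE.
Qed.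

Definition spectral_proj (x : R) : 'M[R]_n := orthproj (eigenspace A x).

Lemma spectral_proj_mul x : spectral_proj x *m A = x *: spectral_proj x.
Proof. exact/eigenspaceP/orthproj_sub. Qed.

Lemma mul_spectral_proj x : A *m spectral_proj x = x *: spectral_proj x.
Proof.
apply: trmx_inj; rewrite trmx_mul Asym linearZ /= orthproj_sym.
exact: spectral_proj_mul.
Qed.

Lemma spectral_proj_orth x y :
  x != y -> spectral_proj x *m spectral_proj y = 0.
Proof.
move=> xy; apply/eqP; have : (x - y) *: (spectral_proj x *m spectral_proj y) == 0.
  rewrite scalerBl scalemxAl -spectral_proj_mul -mulmxA mul_spectral_proj.
  by rewrite -scalemxAr subrr.
by rewrite scaler_eq0 subr_eq0 (negPf xy).
Qed.

Lemma spectral_proj_idem x : spectral_proj x *m spectral_proj x = spectral_proj x.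
Proof. exact/orthproj_id/orthproj_sub. Qed.

(** Stated for every injective family [th] covering the spectrum, so that several
    matrices can later share one index type; superfluous values contribute 0. *)
Lemma spectral_resolution : exists rs : seq R,
  (forall x, spectral_proj x != 0 -> x \in rs) /\
  forall (J : finType) (th : J -> R), injective th ->
    (forall x, x \in rs -> x \in codom th) -> \sum_j spectral_proj (th j) = 1%:M.
Proof.
have [rs urs full] := symmetric_eigenspaces Asym; exists rs.
suff res (J : finType) (th : J -> R) : injective th ->
    (forall x, x \in rs -> x \in codom th) -> \sum_j spectral_proj (th j) = 1%:M.
  split=> [x|]; last exact: res.
  apply: contraR => xNrs.
  have -> : spectral_proj x =
      spectral_proj x *m \sum_(j : 'I_(size rs)) spectral_proj rs`_j.
    rewrite (res _ (fun j : 'I_(size rs) => rs`_j)) ?mulmx1 //.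
      by move=> i j /eqP; rewrite nth_uniq // => /eqP/val_inj.
    move=> y yrs; apply/codomP; have yi : (index y rs < size rs)%N by rewrite index_mem.
    by exists (Ordinal yi); rewrite /= nth_index.
  rewrite mulmx_sumr big1 // => j _; apply: spectral_proj_orth.
  by apply: contraNneq xNrs => ->; apply: mem_nth.
move=> thI rsth.
have : (1%:M <= kermx (\sum_j spectral_proj (th j) - 1%:M))%MS.
  apply: submx_trans full _; rewrite big_seq.
  apply: (big_ind (fun W : 'M[R]_n => (W <= _)%MS)); first exact: sub0mx.
    by move=> W1 W2 s1 s2; rewrite addsmx_sub s1.
  move=> x /rsth/codomP[j ->]; apply/sub_kermxP.
  rewrite mulmxBr mulmx1 mulmx_sumr (bigD1 j) //= orthproj_id //.
  rewrite big1 ?addr0 ?subrr // => k kj.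
  rewrite -(orthproj_id (submx_refl (eigenspace A (th j)))) -mulmxA.
  by rewrite (spectral_proj_orth (x := th j)) ?mulmx0 // (inj_eq thI) eq_sym.
by move/sub_kermxP; rewrite mul1mx => /eqP; rewrite subr_eq0 => /eqP.
Qed.

End Eigenprojection.

(** * Local components of a rooted graph *)

Section VertexFunctions.
Variables (R : realType) (T : finType).
Implicit Types (h : T -> R) (v : 'cV[R]_#|T|).

Lemma coord_vfun h x : coord_at (vfun h) x = h x.
Proof. by rewrite /coord_at mxE enum_rankK. Qed.

Lemma vfun_coord v : vfun (coord_at v) = v.
Proof. by apply/colP => k; rewrite mxE /coord_at enum_valK. Qed.

Lemma eq_vfun h1 h2 : h1 =1 h2 -> vfun h1 = vfun h2.
Proof. by move=> eqh; apply/colP => k; rewrite !mxE eqh. Qed.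

Lemma vfun_inj h1 h2 : vfun h1 = vfun h2 -> h1 =1 h2.
Proof. by move=> eqv x; rewrite -coord_vfun eqv coord_vfun. Qed.

Lemma sum_enum_val (F : T -> R) : \sum_(k < #|T|) F (enum_val k) = \sum_x F x.
Proof.
rewrite [RHS](reindex (@enum_val T predT)) //=.
by exists enum_rank => k _; rewrite ?enum_valK ?enum_rankK.
Qed.

Lemma vfun_dot h1 h2 : ((vfun h1)^T *m vfun h2) 0 0 = \sum_x h1 x * h2 x.
Proof. by rewrite -sum_enum_val mxE; apply: eq_bigr => k _; rewrite !mxE. Qed.

Definition nbr_sum (e : rel T) h (x : T) : R := \sum_(y | e x y) h y.

Lemma adjmx_vfun (e : rel T) h : adjmx R e *m vfun h = vfun (nbr_sum e h).
Proof.
apply/colP => k; rewrite !mxE /nbr_sum [RHS]big_mkcond -sum_enum_val.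
apply: eq_bigr => j _; rewrite !mxE.
by case: (e _ _); rewrite ?mul1r ?mul0r.
Qed.

Lemma adjmx_sym (e : rel T) : symmetric e -> (adjmx R e)^T = adjmx R e.
Proof. by move=> esym; apply/matrixP => i j; rewrite !mxE esym. Qed.

End VertexFunctions.

Section LocalComponents.
Variables (R : realType) (T : finType) (e : rel T) (r : T).
Hypothesis esym : symmetric e.

Let A := adjmx R e.
Let Asym : A^T = A := adjmx_sym R esym.

(** The component at [x] of the root vector in its decomposition into eigenvectors,
    as a function on vertices. *)
Definition local_comp (x : R) (u : T) : R :=
  coord_at (eigenproj e x *m basis_vec R r) u.

Let compE x : eigenproj e x *m basis_vec R r = vfun (local_comp x).
Proof. by rewrite -[LHS]vfun_coord. Qed.

Let projE x : eigenproj e x = spectral_proj A x.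
Proof. by []. Qed.

Lemma local_comp_adj x u : nbr_sum e (local_comp x) u = x * local_comp x u.
Proof.
rewrite -(coord_vfun (nbr_sum _ _)) -adjmx_vfun -compE projE mulmxA.
rewrite (mul_spectral_proj Asym) -scalemxAl -projE compE.
by rewrite {1}/coord_at !mxE enum_rankK.
Qed.

Lemma local_comp_orth x y : x != y ->
  \sum_u local_comp x u * local_comp y u = 0.
Proof.
move=> xy; rewrite -vfun_dot -!compE !projE trmx_mul (orthproj_sym (eigenspace A x)).
rewrite -mulmxA (mulmxA (orthproj _)) (spectral_proj_orth Asym xy).
by rewrite mul0mx mulmx0 mxE.
Qed.

Lemma local_weightE x : local_weight R e r x = \sum_u local_comp x u ^+ 2.
Proof. by rewrite /local_weight compE vfun_dot. Qed.

(** A symmetric idempotent P satisfies <e, P e> = |P e|^2. *)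
Lemma local_comp_root x : local_comp x r = local_weight R e r x.
Proof.
rewrite /local_weight projE trmx_mul (orthproj_sym (eigenspace A x)).
rewrite -mulmxA (mulmxA (orthproj _)) (spectral_proj_idem A x).
rewrite -projE compE vfun_dot (bigD1 r) //= eqxx mul1r big1 ?addr0 //.
by move=> u /negPf ->; rewrite mul0r.
Qed.

Lemma local_weight_ge0 x : 0 <= local_weight R e r x.
Proof. by rewrite local_weightE sumr_ge0 // => u _; apply: sqr_ge0. Qed.

Lemma local_spectrumP x :
  local_spectrum R e r x <-> local_weight R e r x != 0.
Proof.
rewrite /local_spectrum /=; split; apply: contra => /eqP E.
  rewrite compE; apply/eqP/colP => k; rewrite mxE [RHS]mxE.
  move/eqP: E; rewrite local_weightE psumr_eq0 => [/allP E|u _].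
    by apply/eqP; rewrite -sqrf_eq0; apply: E; rewrite mem_index_enum.
  exact: sqr_ge0.
by rewrite /local_weight E mulmx0 mxE.
Qed.

Lemma local_comp_eq0 x u : local_weight R e r x = 0 -> local_comp x u = 0.
Proof.
rewrite local_weightE => /eqP; rewrite psumr_eq0 => [/allP E|v _].
  by apply/eqP; rewrite -sqrf_eq0; apply: E; rewrite mem_index_enum.
exact: sqr_ge0.
Qed.

Lemma local_resolution : exists rs : seq R,
  (forall x, local_spectrum R e r x -> x \in rs) /\
  forall (J : finType) (th : J -> R), injective th ->
    (forall x, x \in rs -> x \in codom th) ->
    forall u, \sum_j local_comp (th j) u = (u == r)%:R.
Proof.
have [rs [rsP res]] := spectral_resolution Asym; exists rs; split.
  by move=> x xP; apply: rsP; apply: contraNneq xP => x0; rewrite projE x0 mul0mx.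
move=> J th thI rsth u; have := res J th thI rsth.
move/(congr1 (fun M => coord_at (M *m basis_vec R r) u)).
rewrite mul1mx coord_vfun => <-; rewrite mulmx_suml /coord_at summxE.
by apply: eq_bigr => j _.
Qed.

End LocalComponents.

Section Equitable.
Variables (R : realType) (T : finType) (e : rel T) (r : T) (d : nat).
Hypothesis F : admissible_factor e r d.

Definition radial (h : T -> R) :=
  forall u v, gdist e r u = gdist e r v -> h u = h v.

Lemma gdist_root u : (gdist e r u == gdist e r r) = (u == r).
Proof.
apply/eqP/eqP => [|->//].
have T0 : (0 < #|T|)%N by apply/card_gt0P; exists r.
have walk0 v : walk e 0 r v = (v == r).
  apply/existsP/eqP => [[p]|->]; last by exists [tuple]; rewrite /= eqxx.
  by rewrite tuple0 /= eq_sym => /eqP.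
rewrite /gdist; case: #|T| T0 => //= k _; rewrite !walk0 eqxx.
by case: eqP.
Qed.

Lemma gdist_nbr u : e r u -> gdist e r u = 1%N.
Proof.
case: F => -[_ eirr] _ _ _ _ eru.
have ur : u != r by apply: contraTneq eru => ->; rewrite eirr.
have T1 : (1 < #|T|)%N.
  by apply: leq_trans (max_card (pred2 r u)); rewrite card2 eq_sym ur.
have walk0 : walk e 0 r u = false.
  apply/existsP => -[p]; rewrite tuple0 /= eq_sym.
  by rewrite (negPf ur).
have walk1 : walk e 1 r u.
  by apply/existsP; exists [tuple u]; rewrite /= eru eqxx.
by rewrite /gdist; case: #|T| T1 => [|[|k]] //= _; rewrite walk0 walk1.
Qed.

(** This is what equitability says: the sum over the neighbours of u splits into the
    cells, and each cell contributes its value of h times a number that depends on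
    the cell of u only. *)
Lemma nbr_sum_radial h : radial h -> radial (nbr_sum e h).
Proof.
move=> hrad u v uv; case: F => _ _ _ _ equ.
pose P := distance_partition e r.
have Ppart : finset.partition P [set: T]%SET := preim_partitionP _ _.
have inP x C : C \in P -> x \in C -> C = [set y | gdist e r y == gdist e r x]%SET.
  move=> CP xC; case/and3P: Ppart => /eqP cov tI _.
  rewrite -(finset.def_pblock tI CP xC); apply/setP => y; rewrite inE.
  rewrite (@pblock_equivalence_partition _ [rel x y | gdist e r x == gdist e r y]).
  - by rewrite /= eq_sym.
  - by move=> a b c _ _ _; split=> /= [|/eqP ->].
  - by rewrite inE.
  - by rewrite inE.
suff E x : nbr_sum e h x =
    \sum_(D in P) \sum_(y in D) (if e x y then h y else 0).
  rewrite !E; apply: eq_bigr => D DP.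
  have [->|[w wD]] := set_0Vmem D; first by rewrite !big_set0.
  have DE := inP _ _ DP wD.
  have sumD x : \sum_(y in D) (if e x y then h y else 0) =
      h w *+ #|[set y in D | e x y]%SET|.
    rewrite -big_mkcondr -sumr_const; apply: eq_big => [y|y]; first by rewrite inE.
    by rewrite {1}DE inE => /andP[/eqP/hrad -> _].
  rewrite !sumD; congr (_ *+ _).
  have /and3P[/eqP cov tI _] := Ppart.
  have uC : u \in finset.cover P by rewrite cov inE.
  apply: (equ (finset.pblock P u)) => //; first exact: finset.pblock_mem.
    by rewrite finset.mem_pblock.
  have uB : u \in finset.pblock P u by rewrite finset.mem_pblock.
  by rewrite (inP _ _ (finset.pblock_mem uC) uB) inE uv.
rewrite /nbr_sum big_mkcond /= -(set_partition_big _ Ppart).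
by apply: eq_bigl => y; rewrite inE.
Qed.

(** The component is a polynomial in the adjacency matrix applied to the root vector,
    hence radial, and its values on the neighbours of r agree.  Their common value is
    found from the eigenvalue equation at r. *)
Lemma local_comp_nbr (J : finType) (th : J -> R) (j : J) (u : T) :
  injective th -> (forall u, \sum_j local_comp e r (th j) u = (u == r)%:R) ->
  e r u -> local_comp e r (th j) u = th j * local_weight R e r (th j) / d%:R.
Proof.
move=> thI res eru; have [[esym eirr] _ reg d0 _] := F.
have rad (q : {poly R}) : radial (fun v => \sum_k q.[th k] * local_comp e r (th k) v).
  elim/poly_ind: q => [|q c IHq] v w vw.
    by rewrite !big1 // => k _; rewrite horner0 mul0r.
  have E v' : \sum_k (q * 'X + c%:P).[th k] * local_comp e r (th k) v' =
      nbr_sum e (fun v => \sum_k q.[th k] * local_comp e r (th k) v) v' +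
      c * (v' == r)%:R.
    rewrite -res mulr_sumr /nbr_sum [X in _ = X + _]exchange_big -big_split;
      apply: eq_bigr => k _ /=.
    rewrite -mulr_sumr -/(nbr_sum e (local_comp e r (th k)) v') local_comp_adj //.
    by rewrite hornerD hornerM hornerX hornerC mulrDl mulrA.
  rewrite !E (nbr_sum_radial IHq vw); congr (_ + _ * _%:R).
  by rewrite -!gdist_root vw.
have [q qE] := interpolation (codom th) (fun x => (x == th j)%:R).
have compE v : local_comp e r (th j) v = \sum_k q.[th k] * local_comp e r (th k) v.
  rewrite (bigD1 j) //= qE ?codom_f // eqxx mul1r big1 ?addr0 // => k kj.
  by rewrite qE ?codom_f // (inj_eq thI) (negPf kj) mul0r.
have const v : e r v -> local_comp e r (th j) v = local_comp e r (th j) u.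
  by move=> erv; rewrite !compE; apply: rad; rewrite !gdist_nbr.
have dN0 : d%:R != 0 :> R by rewrite pnatr_eq0 -lt0n.
apply: (mulIf dN0); rewrite divfK // -local_comp_root // -local_comp_adj //.
rewrite /nbr_sum (eq_bigr _ const) sumr_const mulr_natr -(reg r).
by congr (_ *+ _); apply: eq_card => y; rewrite !inE.
Qed.
End Equitable.

(** * Exponential sums and product measures *)

Section ExponentialSums.
Variables (R : realType) (I : finType) (lam : I -> R).

Definition expsum (c : I -> R) (z : R) : R := \sum_i c i * expR (z * lam i).

Lemma is_derive_expsum (c : I -> R) (z : R) :
  is_derive z (1 : R) (expsum c) (expsum (fun i => lam i * c i) z).
Proof.
have der1 i : is_derive z (1 : R) (fun z => c i * expR (z * lam i))
    (lam i * c i * expR (z * lam i)).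
  have lin : is_derive z (1 : R) (fun z => z * lam i) (lam i).
    have -> : (fun z : R => z * lam i) = lam i \*: (id : R -> R).
      by apply/funext => y; rewrite /= mulrC.
    by apply: is_derive_eq; rewrite [LHS]mulr1.
  have := is_deriveZ (c i) (@is_derive1_comp R expR ( *%R^~ (lam i)) z _ _
    (is_derive_expR (z * lam i)) lin).
  move/is_derive_eq; apply.
  by rewrite [LHS](mulrC (c i)) [RHS]mulrAC -mulrA mulrCA mulrA.
have seqD (s : seq I) : is_derive z (1 : R)
    (fun z => \sum_(i <- s) c i * expR (z * lam i))
    (\sum_(i <- s) lam i * c i * expR (z * lam i)).
  elim: s => [|i s IHs].
    rewrite big_nil; under eq_fun do rewrite big_nil; exact: is_derive_cst.
  rewrite big_cons; under eq_fun do rewrite big_cons.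
  exact: is_deriveD.
exact: seqD.
Qed.

Lemma derive1_expsum (c : I -> R) : derive1 (expsum c) = expsum (fun i => lam i * c i).
Proof.
by apply/funext => z; rewrite derive1E; apply: derive_val; apply: is_derive_expsum.
Qed.

(** Differentiating k times at 0 shows that all moments sum_i c_i lam_i^k vanish, and
    every function on finitely many points is a polynomial. *)
Lemma expsum_eq0 (c : I -> R) (p : R -> R) :
  (forall z, expsum c z = 0) -> \sum_i c i * p (lam i) = 0.
Proof.
move=> c0.
have mom (q : {poly R}) z : \sum_i c i * q.[lam i] * expR (z * lam i) = 0.
  elim/poly_ind: q z => [|q a IHq] z.
    by rewrite big1 // => i _; rewrite horner0 mulr0 mul0r.
  have q0 : expsum (fun i => c i * q.[lam i]) = (fun=> 0) by apply/funext.
  have := derive1_expsum (fun i => c i * q.[lam i]); rewrite q0.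
  move/(congr1 (fun f => f z)); rewrite derive1_cst => /esym dq.
  have : \sum_i (lam i * (c i * q.[lam i]) * expR (z * lam i) +
                 a * (c i * expR (z * lam i))) = 0.
    by rewrite big_split -mulr_sumr /= [X in X + _]dq add0r -/(expsum c z) c0 mulr0.
  move=> s0; rewrite -[RHS]s0; apply: eq_bigr => i _.
  rewrite hornerD hornerM hornerX hornerC mulrDr mulrDl.
  congr (_ + _); first by rewrite (mulrC (lam i)) mulrA.
  by rewrite (mulrC (c i)) mulrA.
have [q qE] := interpolation (codom lam) p.
rewrite -[RHS](mom q 0); apply: eq_bigr => i _.
by rewrite mul0r expR0 mulr1 qE ?codom_f.
Qed.

End ExponentialSums.

Section ProductExpectation.
Variables (R : comNzRingType) (l : nat) (J : finType).

Lemma sum_prod_ffun (g : 'I_l -> J -> R) :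
  \sum_(f : {ffun 'I_l -> J}) \prod_i g i (f i) = \prod_i \sum_s g i s.
Proof. by rewrite bigA_distr_bigA. Qed.

Lemma sum_prod_ffun1 (g : 'I_l -> J -> R) (i : 'I_l) (a : J -> R) :
  \sum_(f : {ffun 'I_l -> J}) \prod_k g k (f k) * a (f i) =
  (\sum_s g i s * a s) * \prod_(k | k != i) \sum_s g k s.
Proof.
pose g' k s := if k == i then g k s * a s else g k s.
transitivity (\prod_k \sum_s g' k s).
  rewrite -sum_prod_ffun; apply: eq_bigr => f _.
  rewrite (bigD1 i) //= [RHS](bigD1 i) //= /g' eqxx mulrAC; congr (_ * _).
  by apply: eq_bigr => k /negPf ->.
rewrite (bigD1 i) //= /g' eqxx; congr (_ * _).
by apply: eq_bigr => k /negPf ->.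
Qed.

Lemma sum_prod_ffun2 (g : 'I_l -> J -> R) (i j : 'I_l) (a b : J -> R) : i != j ->
  \sum_(f : {ffun 'I_l -> J}) \prod_k g k (f k) * (a (f i) * b (f j)) =
  (\sum_s g i s * a s) * (\sum_s g j s * b s) *
    \prod_(k | (k != i) && (k != j)) \sum_s g k s.
Proof.
move=> ij; pose g' k s := if k == j then g k s * b s else g k s.
transitivity (\sum_(f : {ffun 'I_l -> J}) \prod_k g' k (f k) * a (f i)).
  apply: eq_bigr => f _; rewrite (mulrC (a _)) mulrA; congr (_ * _).
  rewrite (bigD1 j) //= [RHS](bigD1 j) //= /g' eqxx mulrAC; congr (_ * _).
  by apply: eq_bigr => k /negPf ->.
rewrite sum_prod_ffun1 -mulrA /g' (negPf ij); congr (_ * _).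
rewrite (bigD1 j) 1?eq_sym //= eqxx; congr (_ * _).
by apply: eq_bigr => k /andP[_ /negPf ->].
Qed.
End ProductExpectation.

(** * Return operators in boundary coordinates *)

Section BoundaryCore.
Variables (R : realType) (l : nat) (J : finType) (th : J -> R).
Variables (om : 'I_l -> J -> R) (d : 'I_l -> R).
Hypothesis om_ge0 : forall i s, 0 <= om i s.
Hypothesis om_sum : forall i, \sum_s om i s = 1.
Hypothesis om_mean : forall i, \sum_s om i s * th s = 0.

Definition mgf i : R -> R := expsum th (om i).
(** The function eta of the factor; [mgf] is its Phi. *)
Definition log_slope i (z : R) : R := (d i)^-1 * (derive1 (mgf i) z / mgf i z).

(** First and second moments of the weights tilted by exp (z th), normalised:
    Phi' / Phi and Phi'' / Phi. *)
Definition tilted_mean i (z : R) : R := expsum th (fun s => th s * om i s) z / mgf i z.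
Definition tilted_mean2 i (z : R) : R :=
  expsum th (fun s => th s * (th s * om i s)) z / mgf i z.
Definition dlog_slope i (z : R) : R :=
  (d i)^-1 * (tilted_mean2 i z - tilted_mean i z ^+ 2).

Lemma mgf_gt0 i z : 0 < mgf i z.
Proof.
rewrite lt_def sumr_ge0 => [|s _]; last by rewrite mulr_ge0 ?expR_ge0.
rewrite andbT psumr_eq0 => [|s _]; last by rewrite mulr_ge0 ?expR_ge0.
apply/negP => /allP om0; have := om_sum i; rewrite big1 => [/eqP|s _].
  by rewrite eq_sym oner_eq0.
have := om0 s (mem_index_enum s); rewrite mulf_eq0 (gt_eqF (expR_gt0 _)) orbF.
by move/eqP.
Qed.

Let mgf_neq0 i z : mgf i z != 0.
Proof. exact/lt0r_neq0/mgf_gt0. Qed.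

Lemma log_slope_mean i z : log_slope i z = (d i)^-1 * tilted_mean i z.
Proof. by rewrite /log_slope /tilted_mean /mgf derive1_expsum. Qed.

Lemma log_slope0 i : log_slope i 0 = 0.
Proof.
rewrite log_slope_mean /tilted_mean /expsum.
have -> : \sum_s th s * om i s * expR (0 * th s) = 0; last by rewrite mul0r mulr0.
rewrite -[RHS](om_mean i); apply: eq_bigr => s _.
by rewrite mul0r expR0 mulr1 mulrC.
Qed.

Lemma is_derive_log_slope i z : is_derive z (1 : R) (log_slope i) (dlog_slope i z).
Proof.
have -> : log_slope i = (d i)^-1 \*:
    ((expsum th (fun s => th s * om i s)) * (fun y => (mgf i y)^-1)).
  by apply/funext => y; rewrite log_slope_mean.
apply: is_deriveZ; apply: is_derive_eq.
  apply: is_deriveM; first exact: is_derive_expsum.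
  by apply: is_deriveV; [exact: mgf_neq0 | exact: is_derive_expsum].
rewrite /tilted_mean /tilted_mean2; set M1 := expsum _ _ z; set M2 := expsum _ _ z.
rewrite -/M1 /GRing.scale /=.
by rewrite addrC mulNr mulrN expr_div_n (mulrC _ M1) mulrA -expr2 (mulrC _ M2).
Qed.

(** A labelling stands for a joint eigenvalue of the factors: [label_value] is the
    eigenvalue of the product and [label_weight] the mass in the product measure. *)
Definition label_weight (f : {ffun 'I_l -> J}) : R := \prod_i om i (f i).
Definition label_value (f : {ffun 'I_l -> J}) : R := \sum_i th (f i).

Let tilt z i s := om i s * expR (z * th s).

Lemma label_weight_expR z f : label_weight f * expR (z * label_value f) =
  \prod_i tilt z i (f i).
Proof. by rewrite mulr_sumr expR_sum -big_split. Qed.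

Let Ph z := \prod_i mgf i z.

Let tilt_sum1 z i : \sum_s tilt z i s * th s = mgf i z * tilted_mean i z.
Proof.
rewrite mulrCA mulfV // mulr1; apply: eq_bigr => s _.
by rewrite mulrAC (mulrC (om i s)).
Qed.

Let tilt_sum2 z i : \sum_s tilt z i s * (th s * th s) = mgf i z * tilted_mean2 i z.
Proof.
rewrite mulrCA mulfV // mulr1; apply: eq_bigr => s _.
by rewrite mulrAC; congr (_ * _); rewrite mulrC mulrA.
Qed.

Lemma label_weight_mean1 z i :
  \sum_f label_weight f * th (f i) * expR (z * label_value f) = Ph z * tilted_mean i z.
Proof.
under eq_bigr do rewrite mulrAC label_weight_expR.
by rewrite sum_prod_ffun1 tilt_sum1 /Ph [in RHS](bigD1 i) //= mulrAC.
Qed.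

(** Distinct coordinates of a labelling are independent also for the tilted measure;
    on the diagonal the second moment differs from the square of the first by the
    variance. *)
Lemma label_weight_mean2 z i j :
  \sum_f label_weight f * (th (f i) * th (f j)) * expR (z * label_value f) =
  Ph z * (tilted_mean i z * tilted_mean j z +
    (i == j)%:R * (tilted_mean2 i z - tilted_mean i z ^+ 2)).
Proof.
under eq_bigr do rewrite mulrAC label_weight_expR.
have [<-|ij] := eqVneq i j.
  rewrite mul1r expr2 addrCA subrr addr0 (sum_prod_ffun1 _ i (fun s => th s * th s)).
  by rewrite tilt_sum2 /Ph [in RHS](bigD1 i) //= mulrAC.
rewrite mul0r addr0 sum_prod_ffun2 // !tilt_sum1 /Ph [in RHS](bigD1 i) //=.
by rewrite [in RHS](bigD1 j) 1?eq_sym //= mulrACA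
  (mulrAC (mgf i z * _)) -(mulrA (mgf i z)).
Qed.

(** Summed against lam^k over all f, this is the coefficient at b_i of E A^k applied
    to a0 e_a + sum_j a_j b_j. *)
Definition return_term i (a0 : R) (a : 'I_l -> R) f :=
  label_weight f * (th (f i) / d i) * (a0 + \sum_j a j * th (f j)).

(** The variance in [label_weight_mean2], divided by d_i, is the derivative of eta_i. *)
Lemma return_term_expsum i a0 a z :
  expsum label_value (return_term i a0 a) z =
  Ph z * (log_slope i z * (a0 + \sum_j a j * tilted_mean j z) + dlog_slope i z * a i).
Proof.
have -> : expsum label_value (return_term i a0 a) z =
  (d i)^-1 * (a0 * (\sum_f label_weight f * th (f i) * expR (z * label_value f)) +
   \sum_j a j * (\sum_f label_weight f * (th (f i) * th (f j)) * expR (z *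
     label_value f))).
  transitivity (\sum_f (d i)^-1 * (a0 * (label_weight f * th (f i) * expR (z *
    label_value f)) +
     \sum_j a j * (label_weight f * (th (f i) * th (f j)) * expR (z * label_value f)))).
    apply: eq_bigr => f _; rewrite /return_term.
    have -> : \sum_j a j * (label_weight f * (th (f i) * th (f j)) * expR (z *
      label_value f)) =
       (\sum_j a j * th (f j)) * (label_weight f * th (f i) * expR (z * label_value f)).
      rewrite mulr_suml; apply: eq_bigr => j _.
      by rewrite -!mulrA; congr (_ * _); rewrite mulrA mulrCA !mulrA.
    set S := \sum_j _; set w := label_weight f; set t := th _; set x := expR _; lra.
  rewrite -mulr_sumr; congr (_ * _); rewrite big_split /= -mulr_sumr; congr (_ + _).
  by rewrite exchange_big; apply: eq_bigr => j _; rewrite mulr_sumr.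
rewrite label_weight_mean1; under eq_bigr do rewrite label_weight_mean2.
have -> : \sum_j a j * (Ph z * (tilted_mean i z * tilted_mean j z +
    (i == j)%:R * (tilted_mean2 i z - tilted_mean i z ^+ 2))) =
    Ph z * (tilted_mean i z * (\sum_j a j * tilted_mean j z) +
    a i * (tilted_mean2 i z - tilted_mean i z ^+ 2)).
  rewrite mulrDr -[a i * _]mul1r.
  rewrite (_ : 1 * _ = \sum_j a j * ((i == j)%:R *
    (tilted_mean2 i z - tilted_mean i z ^+ 2))).
    rewrite !mulr_sumr -big_split; apply: eq_bigr => j _ /=.
    by rewrite mulrCA mulrDr (mulrCA (a j)) mulrDr.
  rewrite (bigD1 i) //= eqxx big1 ?addr0 ?mul1r // => j /negPf ji.
  by rewrite eq_sym ji mul0r mulr0.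
by rewrite log_slope_mean /dlog_slope; set S := \sum_j _; lra.
Qed.

Lemma dlog_slope_eq i j : log_slope i =1 log_slope j -> dlog_slope i =1 dlog_slope j.
Proof.
move=> /funext eqe z; have [_ <-] := is_derive_log_slope i z; rewrite eqe.
by have [_ ->] := is_derive_log_slope j z.
Qed.

(** The generating function of the left-hand side depends on [i] only through eta_i,
    its derivative and [a i]. *)
Lemma return_term_class i i' a0 a (p : R -> R) : log_slope i =1 log_slope i' ->
  a i = a i' ->
  \sum_f return_term i a0 a f * p (label_value f) =
    \sum_f return_term i' a0 a f * p (label_value f).
Proof.
move=> eqe eqa; apply/eqP; rewrite -subr_eq0 -sumrB.
under eq_bigr do rewrite -mulrBl; apply/eqP/expsum_eq0 => z.
rewrite /expsum; under eq_bigr do rewrite mulrBl.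
rewrite sumrB -!/(expsum _ _ _) !return_term_expsum eqe eqa.
by rewrite (dlog_slope_eq eqe) subrr.
Qed.

Section Separation.
(* U plays the part of the families of coefficients of the vectors of an invariant
   subspace; the family 1 stands for b. *)
Variable U : ('I_l -> R) -> Prop.
Hypothesis U1 : U (fun=> 1).
Hypothesis Ulin : forall c a b, U a -> U b -> U (fun i => c * a i + b i).
Hypothesis Uret : forall k a, U a ->
  U (fun i => \sum_f return_term i 0 a f * label_value f ^+ k).

Let U0 : U (fun=> 0).
Proof.
rewrite (_ : (fun=> 0) = fun i : 'I_l => -1 * 1 + 1); first exact: Ulin.
by apply/funext => i; rewrite mulN1r addNr.
Qed.

Let UZ c a : U a -> U (fun i => c * a i).
Proof.
move=> Ua; rewrite (_ : (fun i => _) = fun i => c * a i + 0); first exact: Ulin.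
by apply/funext => i; rewrite addr0.
Qed.

Let Ufun (p : R -> R) a : U a -> U (fun i => \sum_f return_term i 0 a f *
  p (label_value f)).
Proof.
move=> Ua; have [q qE] := interpolation (codom label_value) p.
rewrite (_ : (fun i => _) = fun i => \sum_f return_term i 0 a f * q.[label_value f]);
  last first.
  apply/funext => i; apply: eq_bigr => f _; by rewrite qE ?codom_f.
rewrite (_ : (fun i => _) =
    fun i => \sum_(k < size q) q`_k * \sum_f return_term i 0 a f * label_value f ^+ k).
  elim: (index_enum _) => [|k s IHs].
    by under eq_fun do rewrite big_nil.
  by under eq_fun do rewrite big_cons; apply: Ulin; first exact: Uret.
apply/funext => i; under [RHS]eq_bigr do rewrite mulr_sumr.
rewrite exchange_big; apply: eq_bigr => f _; rewrite horner_coef mulr_sumr.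
by apply: eq_bigr => k _; rewrite mulrCA.
Qed.

(** Since the th (f j) add up to lam, E p(A) E with p(x) = (exp (z x) - 1) / x maps the
    family 1 to Phi eta(z): the factor lam cancels, and the constant -1 contributes
    the mean of th (f i), which is 0. *)
Let Ulog_slope z : U (fun i => Ph z * log_slope i z).
Proof.
have := Ufun (fun x => (expR (z * x) - 1) / x) U1.
rewrite (_ : (fun i => \sum__ _) = fun i => Ph z * log_slope i z) //.
apply/funext => i.
have -> : Ph z * log_slope i z = expsum label_value (return_term i 1 (fun=> 0)) z.
  rewrite return_term_expsum big1 ?addr0 ?mulr1 ?mulr0 ?addr0 // => j _; exact: mul0r.
have : \sum_f return_term i 1 (fun=> 0) f = 0.
  transitivity (expsum label_value (return_term i 1 (fun=> 0)) 0).
    by apply: eq_bigr => f _; rewrite mul0r expR0 mulr1.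
  rewrite return_term_expsum log_slope0 mul0r mulr0 addr0 mulr0 //.
rewrite /expsum => s0; rewrite -[RHS]subr0 -[X in _ = _ - X]s0 -sumrB;
  apply: eq_bigr => f _.
have -> : return_term i 1 (fun=> 0) f = label_weight f * (th (f i) / d i).
  by rewrite /return_term big1 ?addr0 ?mulr1 // => j _; exact: mul0r.
have -> : return_term i 0 (fun=> 1) f =
  label_weight f * (th (f i) / d i) * label_value f.
  by rewrite /return_term add0r; under eq_bigr do rewrite mul1r.
have [->|lf] := eqVneq (label_value f) 0;
  first by rewrite !mulr0 mul0r expR0 mulr1 subrr.
by rewrite -mulrA (mulrC (label_value f)) divfK // mulrBr mulr1.
Qed.

Let Ph_neq0 z : Ph z != 0.
Proof. by apply/prodf_neq0 => i _; apply: mgf_neq0. Qed.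

(** The operator E exp(z A) E maps a to a multiple of eta(z) plus Phi eta'(z) a, and the
    first part is already in U. *)
Let Udlog_slope z a : U a -> U (fun i => dlog_slope i z * a i).
Proof.
move=> Ua; have := Ulin (- \sum_j a j *
  tilted_mean j z) (Ulog_slope z) (Ufun (fun x => expR (z * x)) Ua).
move=> /(UZ (Ph z)^-1); rewrite (_ : (fun i => _) = fun i => dlog_slope i z * a i) //.
apply/funext => i; rewrite -/(expsum label_value
  (return_term i 0 a) z) return_term_expsum add0r.
by rewrite -[RHS](mulKf (Ph_neq0 z)); congr (_ * _); set S := \sum_j _; lra.
Qed.

Lemma log_slope_eq i j : dlog_slope i =1 dlog_slope j -> log_slope i =1 log_slope j.
Proof.
move=> eqd z; apply/eqP; rewrite -subr_eq0; apply/eqP.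
transitivity (log_slope i 0 - log_slope j 0); last by rewrite !log_slope0 subrr.
apply: (@is_derive_0_is_cst R (log_slope i - log_slope j)) => y.
rewrite -[X in is_derive _ _ _ X](subrr (dlog_slope i y)) {2}eqd.
by apply: is_deriveB; apply: is_derive_log_slope.
Qed.

(** For each class other than that of [i] choose z at which its value of eta' differs
    from that at [i]; the product of the corresponding affine functions of eta' is
    the indicator. *)
Lemma class_indicator i : U (fun j => `[< log_slope i =1 log_slope j >]%:R).
Proof.
have sep (s : seq 'I_l) : exists2 a, U a &
    (forall j, log_slope i =1 log_slope j -> a j = 1) /\
    (forall j, j \in s -> ~ log_slope i =1 log_slope j -> a j = 0).
  elim: s => [|k s [a Ua [a1 a0]]]; first by exists (fun=> 1).
  have [ik|Nik] := pselect (log_slope i =1 log_slope k).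
    by exists a => //; split=> // j; rewrite inE => /predU1P[->|/a0].
  have [z zik] : exists z, dlog_slope i z != dlog_slope k z.
    apply: contrapT => eqd; apply: Nik; apply: log_slope_eq => z.
    by apply: contrapT => /eqP ne; apply: eqd; exists z.
  have c0 : dlog_slope i z - dlog_slope k z != 0 by rewrite subr_eq0.
  exists (fun j => (dlog_slope i z - dlog_slope k z)^-1 * (- dlog_slope k z * a j +
    dlog_slope j z * a j)).
    exact/UZ/Ulin/Udlog_slope.
  split=> j; rewrite -mulrDl (addrC (- _)).
    by move=> ij; rewrite a1 // mulr1 -(dlog_slope_eq ij) mulVf.
  rewrite inE => /predU1P[->|js] Nij; first by rewrite subrr mul0r mulr0.
  by rewrite (a0 j js Nij) !mulr0.
have [a Ua [a1 a0]] := sep (enum 'I_l).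
rewrite (_ : (fun _ => _) = a) //; apply/funext => j.
case: asboolP => [/a1 -> //|/a0 -> //]; exact: mem_enum.
Qed.
End Separation.
End BoundaryCore.

(** * Joint eigenvectors of a Cartesian product *)

Section DependentProduct.
Variables (R : comNzRingType) (l : nat) (F : 'I_l -> finType).

(** The analogue of [bigA_distr_bigA] for a product over a dependent family of types. *)
Lemma sum_prod_dffun (g : forall i, F i -> R) :
  \sum_(x : {dffun forall i, F i}) \prod_i g i (x i) = \prod_i \sum_u g i u.
Proof.
pose P i := [ffun u => g i u].
transitivity (\sum_(t : fprod F) \prod_i P i (t i)).
  rewrite (reindex (@dffun_of_fprod _ F)); last exact/onW_bij/dffun_of_fprod_bij.
  by apply: eq_bigr => t _; apply: eq_bigr => i _; rewrite !ffunE.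
rewrite big_fprod -(bigA_distr_big_dep (fun i => tagged_with F i)
  (fun i j => untag 0 (P i) j)).
apply: eq_bigr => i _; rewrite -(big_tag (fun i u => P i u)).
by apply: eq_bigr => u _; exact: ffunE.
Qed.
End DependentProduct.

Section BoxGraph.
Variables (l : nat) (F : 'I_l -> finType) (e : forall i, rel (F i)).
Arguments e : clear implicits.
Variable (r : forall i, F i).
Hypothesis eirr : forall i, irreflexive (e i).

Local Notation box := (box_vertex F).

Definition box_update (x : box) (i : 'I_l) (u : F i) : box :=
  [ffun k => dfwith (fun k => x k) i u k].

Lemma box_update_same x i u : box_update x u i = u :> F i.
Proof. by rewrite ffunE dfwithin. Qed.

Lemma box_update_other x i (u : F i) k : k != i -> box_update x u k = x k.
Proof. by move=> ki; rewrite ffunE dfwithout // eq_sym. Qed.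

Lemma box_stepP i (x y : box) :
  reflect (exists2 u, e i (x i) u & y = box_update x u) (box_step e i x y).
Proof.
apply: (iffP andP) => [[exy /forall_inP eqxy]|[u exu ->]].
  exists (y i) => //; apply/ffunP => k.
  have [->|ki] := eqVneq k i; first by rewrite box_update_same.
  by rewrite box_update_other // (eqP (eqxy k ki)).
split; first by rewrite box_update_same.
by apply/forall_inP => k ki; rewrite box_update_other.
Qed.

Lemma box_step_unique i j (x y : box) :
  box_step e i x y -> box_step e j x y -> i = j.
Proof.
move=> /andP[exy _] /andP[_ /forall_inP eqxy]; apply/eqP.
apply: contraTT exy => ij; by rewrite (eqP (eqxy i ij)) eirr.
Qed.

(** At most one direction leads from [x] to [y], as the factors have no loops. *)
Lemma box_edgeE (R : nzSemiRingType) (x y : box) :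
  (box_edge e x y)%:R = \sum_i (box_step e i x y)%:R :> R.
Proof.
have [/existsP[i xy]|/existsPn nxy] := boolP (box_edge e x y).
  rewrite (bigD1 i) //= xy big1 ?addr0 // => j ji.
  case xyj: box_step => //; move: ji.
  by rewrite (box_step_unique xyj xy) eqxx.
by rewrite big1 // => i _; rewrite (negPf (nxy i)).
Qed.

Lemma sum_box_step (R : nmodType) (h : box -> R) i x :
  \sum_(y | box_step e i x y) h y = \sum_(u | e i (x i) u) h (box_update x u).
Proof.
rewrite (reindex_onto (@box_update x i) (fun y => y i)) /=.
  apply: eq_bigl => u; rewrite box_update_same eqxx andbT.
  apply/box_stepP/idP => [[v exv /(congr1 (fun y : box => y i))]|exu].
    by rewrite !box_update_same => ->.
  by exists u.
by move=> y /box_stepP[u _ ->]; rewrite box_update_same.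
Qed.

Lemma nbr_sum_box (R : realType) (h : box -> R) x :
  nbr_sum (box_edge e) h x = \sum_i \sum_(u | e i (x i) u) h (box_update x u).
Proof.
rewrite /nbr_sum big_mkcond.
under eq_bigr => y _ do rewrite -mulrb -mulr_natl box_edgeE mulr_suml.
rewrite exchange_big; apply: eq_bigr => i _; rewrite -sum_box_step [RHS]big_mkcond.
by apply: eq_bigr => y _; case: box_step; rewrite ?mul1r ?mul0r.
Qed.

End BoxGraph.

Section ProductEigenvectors.
Variables (R : realType) (l : nat) (F : 'I_l -> finType) (e : forall i, rel (F i)).
Variables (r : forall i, F i) (d : 'I_l -> nat).
Arguments e : clear implicits.
Hypothesis hF : forall i, admissible_factor (e i) (r i) (d i).
Variables (J : finType) (th : J -> R).
Hypothesis th_inj : injective th.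
Hypothesis th_res : forall i u,
  \sum_s local_comp (e i) (r i) (th s) u = (u == r i)%:R.

Local Notation box := (box_vertex F).
Local Notation a := (box_root r).

Definition factor_weight i s : R := local_weight R (e i) (r i) (th s).

Let esymm i : symmetric (e i).
Proof. by case: (hF i) => -[]. Qed.

Let eirr i : irreflexive (e i).
Proof. by case: (hF i) => -[]. Qed.

Definition factor_comp i s u : R := local_comp (e i) (r i) (th s) u.

Definition joint_vec (f : {ffun 'I_l -> J}) (x : box) : R :=
  \prod_i factor_comp (f i) (x i).

Lemma joint_vec_update f x i (u : F i) :
  joint_vec f (box_update x u) = factor_comp (f i) u *
    \prod_(k | k != i) factor_comp (f k) (x k).
Proof.
rewrite /joint_vec (bigD1 i) //= box_update_same; congr (_ * _).
by apply: eq_bigr => k ki; rewrite box_update_other.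
Qed.

Lemma joint_vec_adj f x : nbr_sum (box_edge e) (joint_vec f) x =
  label_value th f * joint_vec f x.
Proof.
rewrite nbr_sum_box // mulr_suml; apply: eq_bigr => i _.
under eq_bigr do rewrite joint_vec_update.
rewrite -mulr_suml -/(nbr_sum (e i) (@factor_comp i (f i)) (x i)) local_comp_adj //.
by rewrite -mulrA /joint_vec [in RHS](bigD1 i).
Qed.

Lemma joint_vec_root f : joint_vec f a = label_weight factor_weight f.
Proof. by apply: eq_bigr => i _; rewrite ffunE /factor_comp local_comp_root. Qed.

(** Moving along the coordinate [i] from the root changes that factor of the product
    only, where [local_comp_nbr] gives the new value. *)
Lemma joint_vec_boundary f x i : box_step e i a x ->
  joint_vec f x = label_weight factor_weight f * (th (f i) / (d i)%:R).
Proof.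
move=> /box_stepP[u]; rewrite ffunE => eu ->.
rewrite joint_vec_update {1}/factor_comp (local_comp_nbr
  (hF i)) // /label_weight [in RHS](bigD1 i) //=.
rewrite -/(factor_weight i (f i));
  under eq_bigr do rewrite ffunE /factor_comp local_comp_root -/(factor_weight _ _) //.
rewrite -!mulrA; set P := \prod_(_ | _) _; lra.
Qed.

Lemma sum_joint_vec x : \sum_f joint_vec f x = (x == a)%:R.
Proof.
rewrite /joint_vec (sum_prod_ffun (fun i s => factor_comp s (x i))).
under eq_bigr do rewrite th_res.
have [->|xa] := eqVneq x a; first by rewrite big1 // => i _; rewrite ffunE eqxx.
have [i xi] : exists i, x i != r i.
  apply/existsP; apply: contraR xa => /existsPn xr; apply/eqP/ffunP => i.
  by rewrite ffunE; apply/eqP; have := xr i; rewrite negbK.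
by rewrite (bigD1 i) //= (negPf xi) mul0r.
Qed.

(** The sum of the th s times the components is A_i e_(r_i), the indicator of the
    neighbours of the root. *)
Lemma sum_th_factor_comp i u : \sum_s factor_comp s u * th s = (e i (r i) u)%:R.
Proof.
under eq_bigr do rewrite mulrC -local_comp_adj //.
rewrite /nbr_sum exchange_big /=; under eq_bigr do rewrite th_res.
rewrite big_mkcond (bigD1 (r i)) //= eqxx big1 ?addr0 => [|v /negPf ->].
  by rewrite esymm; case: e.
by case: e.
Qed.

Lemma sum_th_joint_vec i x :
  \sum_(f : {ffun 'I_l -> J}) th (f i) * joint_vec f x = (box_step e i a x)%:R.
Proof.
under eq_bigr do rewrite mulrC /joint_vec.
rewrite (sum_prod_ffun1 (fun k s => factor_comp s (x k))) sum_th_factor_comp.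
under eq_bigr do rewrite th_res.
rewrite /box_step ffunE -mulnb natrM; congr (_ * _).
case: forall_inP => [xr|nxr].
  by rewrite big1 // => k ki; rewrite -(eqP (xr k ki)) ffunE eqxx.
have [k /andP[ki xk]] : exists k, (k != i) && (x k != r k).
  apply/existsP; apply: contra_notT nxr => /existsPn xr k ki.
  by have := xr k; rewrite ki /= negbK ffunE eq_sym.
by rewrite (bigD1 k) //= (negPf xk) mul0r.
Qed.

Lemma joint_vec_orth f f' : f != f' -> \sum_x joint_vec f x * joint_vec f' x = 0.
Proof.
move=> ff; under eq_bigr do rewrite /joint_vec -big_split /=.
rewrite (sum_prod_dffun (fun i u => factor_comp (f i) u * factor_comp (f' i) u)).
have [i fi] : exists i, f i != f' i.
  apply/existsP; apply: contraR ff => /existsPn eqf; apply/eqP/ffunP => i.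
  by apply/eqP; have := eqf i; rewrite negbK.
by rewrite (bigD1 i) //= local_comp_orth ?mul0r // (inj_eq th_inj).
Qed.

Lemma factor_weight_ge0 i s : 0 <= factor_weight i s.
Proof. by apply: local_weight_ge0. Qed.

Lemma factor_weight_sum i : \sum_s factor_weight i s = 1.
Proof.
under eq_bigr do rewrite /factor_weight -local_comp_root //.
by rewrite th_res eqxx.
Qed.

Lemma factor_weight_mean i : \sum_s factor_weight i s * th s = 0.
Proof.
under eq_bigr do rewrite /factor_weight -local_comp_root //.
by rewrite sum_th_factor_comp eirr.
Qed.

(** The number of closed walks of length 2 at the root, which is how the valency is
    read off from the local measure. *)
Lemma factor_weight_mean2 i : \sum_s factor_weight i s * th s ^+ 2 = (d i)%:R.
Proof.
transitivity (\sum_s \sum_(u | e i (r i) u) factor_comp s u * th s).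
  apply: eq_bigr => s _.
  rewrite -mulr_suml -/(nbr_sum (e i) (@factor_comp i s) (r i)) local_comp_adj //.
  by rewrite local_comp_root // -/(factor_weight i s) expr2 mulrA (mulrC (th s)).
rewrite exchange_big /=; under eq_bigr do rewrite sum_th_factor_comp.
have [_ _ reg _ _] := hF i.
rewrite -(reg (r i)) -sum1_card natr_sum [RHS]big_mkcond [LHS]big_mkcond.
by apply: eq_bigr => u _; rewrite inE; case: e.
Qed.

End ProductEigenvectors.

(** * Least subspaces, ranks and sums of eigenspaces *)

Section LinearAlgebra.
Variable K : fieldType.

Lemma smallest_vs_eq (vT : vectType K) (P : set {vspace vT}) U :
  P U -> (forall W, P W -> (U <= W)%VS) -> smallest_vs P = U.
Proof.
move=> PU Umin; apply: xget_unique => [|W [PW Wmin]]; first by split.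
by apply: subv_anti; rewrite Umin // Wmin.
Qed.

Lemma mem_span_set (vT : vectType K) (S : set vT) v : S v -> v \in span_set S.
Proof.
move=> Sv.
have [|U W SU SW w Sw|H _] := @smallest_vsP K vT [set U | forall v, S v -> v \in U].
- by exists fullv => w _; apply: memvf.
- by rewrite memv_cap SU ?SW.
- exact: H.
Qed.

(** Through the factorisation of M into an injective and a surjective map. *)
Lemma dim_limg_mulmx m n (M : 'M[K]_(m, n)) :
  \dim (limg (linfun (mulmx M) : 'Hom('cV[K]_n, 'cV[K]_m))) = \rank M.
Proof.
pose f := linfun (mulmx (col_base M)) : 'Hom('cV[K]_(\rank M), 'cV[K]_m).
have -> : limg (linfun (mulmx M) : 'Hom('cV[K]_n, 'cV[K]_m)) = limg f.
  apply: subv_anti; apply/andP; split; apply/subvP => _ /memv_imgP[v _ ->].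
    rewrite lfunE /= -{1}(mulmx_base M) -mulmxA.
    by have := memv_img f (memvf (row_base M *m v)); rewrite lfunE.
  have /row_freeP[N NR] := row_base_free M.
  have := memv_img (linfun (mulmx M) : 'Hom('cV[K]_n, 'cV[K]_m)) (memvf (N *m v)).
  by rewrite !lfunE /= -{1}(mulmx_base M) -mulmxA (mulmxA (row_base M)) NR mul1mx.
rewrite limg_dim_eq; first by rewrite dimvf dim_matrix [LHS]muln1.
apply/eqP; rewrite -subv0; apply/subvP => v; rewrite memv_cap memv_ker lfunE /=.
move=> /andP[_ /eqP v0]; have /row_fullP[N NC] := col_base_full M.
by rewrite -[v]mul1mx -NC -mulmxA v0 mulmx0 mem0v.
Qed.

(** A relation sum_j u_j = 0 between eigenvectors yields sum_j q(x_j) u_j = 0 for every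
    polynomial q; take q equal to 1 at one eigenvalue and to 0 at the others. *)
Lemma directv_eigen (n m : nat) (A : 'M[K]_n) (x : 'I_m -> K)
    (V : 'I_m -> {vspace 'cV[K]_n}) : injective x ->
  (forall i v, v \in V i -> A *m v = x i *: v) ->
  \dim (\sum_i V i)%VS = (\sum_i \dim (V i))%N.
Proof.
move=> xI VA; apply/eqP; rewrite -/(directv _).
apply/directv_sum_independent => us Vus us0 i _.
have pol (q : {poly K}) : \sum_j q.[x j] *: us j = 0.
  elim/poly_ind: q => [|q c IHq].
    by rewrite big1 // => j _; rewrite horner0 scale0r.
  transitivity (A *m (\sum_j q.[x j] *: us j) + c *: \sum_j us j); last first.
    by rewrite IHq us0 mulmx0 scaler0 addr0.
  rewrite mulmx_sumr scaler_sumr -big_split; apply: eq_bigr => j _ /=.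
  rewrite -scalemxAr (VA j) ?Vus // scalerA -scalerDl.
  by rewrite hornerD hornerM hornerX hornerC.
have [q qE] := interpolation (codom x) (fun y => (y == x i)%:R).
rewrite -(pol q) (bigD1 i) //= qE ?codom_f // eqxx scale1r big1 ?addr0 // => j ji.
by rewrite qE ?codom_f // (inj_eq xI) (negPf ji) scale0r.
Qed.

End LinearAlgebra.

(** * The punctured graph *)

Section PuncturedGraph.
Variables (R : realType) (T : finType) (e : rel T) (a : T).
Hypothesis esym : symmetric e.

Local Notation n := #|punctured a|.
Local Notation B := (adj_punctured R e a).
Local Notation b := (nbr_vec R e a).
Local Notation E := (nbr_diag R e a).
Local Notation fr := (@forget_root R T a).

Lemma forget_root_vfun (h : T -> R) : fr (vfun h) =
  vfun (fun x : punctured a => h (val x)).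
Proof. by apply/colP => k; rewrite !mxE enum_rankK. Qed.

(** A step of A differs from one of B only by the step through the root, which
    deposits the value at the root on its neighbours. *)
Lemma forget_root_adj (h : T -> R) :
  B *m fr (vfun h) = fr (vfun (nbr_sum e h)) - h a *: b.
Proof.
rewrite !forget_root_vfun /adj_punctured adjmx_vfun; apply/colP => k; rewrite !mxE.
move: (enum_val k) => x; rewrite /nbr_sum [in RHS]big_mkcond (bigD1 a) //=.
rewrite esym -mulrb mulrC addrAC mulr_natl subrr add0r -big_mkcondr.
rewrite (reindex_omap (val : punctured a -> T) insub) => [|y /andP[ya _]];
  last by rewrite insubT.
by apply: eq_bigl => y; rewrite valK eqxx andbT (valP y).
Qed.

Lemma nbr_diag_vfun (g : punctured a -> R) :
  E *m vfun g = vfun (fun x => (e a (val x))%:R * g x).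
Proof. by apply/colP => k; rewrite mul_diag_mx !mxE. Qed.

Lemma forget_root_eq0 (v : 'cV[R]_#|T|) : fr v = 0 -> v = coord_at v a *: basis_vec R a.
Proof.
rewrite -{1 2}(vfun_coord v) forget_root_vfun => fv0; apply/colP => k; rewrite !mxE.
have [->|ka] := eqVneq (enum_val k) a; first by rewrite mulr1.
have fv0' : vfun (fun x : punctured a => coord_at v (val x)) = vfun (fun=> 0).
  by rewrite fv0; apply/colP => j; rewrite !mxE.
by have := vfun_inj fv0' (Sub (enum_val k) ka); rewrite SubK mulr0.
Qed.

Lemma local_algebraP :
  [/\ 1%:M \in local_algebra R e a, B \in local_algebra R e a,
    E \in local_algebra R e a &
    forall M N, M \in local_algebra R e a -> N \in local_algebra R e a ->
      M *m N \in local_algebra R e a] /\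
  forall W : {vspace 'M[R]_n}, [/\ 1%:M \in W, B \in W, E \in W &
    forall M N, M \in W -> N \in W -> M *m N \in W] -> (local_algebra R e a <= W)%VS.
Proof.
apply: smallest_vsP; first by exists fullv; split=> *; apply: memvf.
move=> U W [U1 UB UE UM] [W1 WB WE WM]; split; rewrite ?memv_cap ?U1 ?UB ?UE //.
by move=> M N; rewrite !memv_cap => /andP[MU MW] /andP[NU NW]; rewrite UM ?WM.
Qed.

Lemma ones_local_module : ones_vec R a \in local_module R e a.
Proof.
have [[A1 _ _ _] _] := local_algebraP.
by have := memv_img (linfun (mulmxr (ones_vec R a))) A1; rewrite lfunE /= mul1mx.
Qed.

Lemma local_module_stable M v : M \in local_algebra R e a ->
  v \in local_module R e a -> M *m v \in local_module R e a.
Proof.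
have [[_ _ _ AM] _] := local_algebraP => MA /memv_imgP[N NA ->].
rewrite lfunE /= mulmxA.
by have := memv_img (linfun (mulmxr (ones_vec R a))) (AM _ _ MA NA); rewrite lfunE.
Qed.

(** The matrices that map U into itself form an algebra with B and E in it, so the
    local algebra is among them. *)
Lemma local_module_min (U : {vspace 'cV[R]_n}) :
  ones_vec R a \in U -> (forall v, v \in U -> B *m v \in U) ->
  (forall v, v \in U -> E *m v \in U) -> (local_module R e a <= U)%VS.
Proof.
move=> U1 UB UE.
(* The stabiliser of U, cut out by its action on a basis. *)
pose W := (\bigcap_(i < \dim U) (linfun (mulmxr (vbasis U)`_i) @^-1: U))%VS
   : {vspace 'M[R]_n}.
have WP M : reflect (forall v, v \in U -> M *m v \in U) (M \in W).
  apply: (iffP idP) => [|MU].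
    rewrite memvE => /subv_bigcapP MW v vU; rewrite (coord_vbasis vU) mulmx_sumr.
    rewrite memv_suml // => i _; rewrite -scalemxAr memvZ //.
    by have := MW i isT; rewrite -memvE -memv_preim lfunE.
  rewrite memvE; apply/subv_bigcapP => i _; rewrite -memvE -memv_preim lfunE /=.
  by apply: MU; apply: vbasis_mem; rewrite mem_nth // size_tuple.
have [_ Amin] := local_algebraP.
have AW : (local_algebra R e a <= W)%VS.
  apply: Amin; split; try apply/WP => //; first by move=> v; rewrite mul1mx.
  by move=> M N /WP MU /WP NU; apply/WP => v vU; rewrite -mulmxA; apply/MU/NU.
apply/subvP => _ /memv_imgP[M /(subvP AW)/WP MU ->].
by rewrite lfunE /=; apply: MU.
Qed.

(** [h k] runs through A^k (h 0).  Every passage through the root returns as a multiple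
    of b, so E A^k (h 0) differs from E B^k (h 0) by a combination of the E B^j b. *)
Lemma boundary_words (U : {vspace 'cV[R]_n}) (h : nat -> T -> R) :
  b \in U -> (forall k v, v \in U -> return_mx R e a k *m v \in U) ->
  (forall k, h k.+1 =1 nbr_sum e (h k)) ->
  fr (vfun (h 0%N)) \in U -> E *m fr (vfun (h 0%N)) = fr (vfun (h 0%N)) ->
  forall k, E *m fr (vfun (h k)) \in U.
Proof.
move=> bU Uret hS h0U h0E k.
(* The induction needs all B^j in front, as a step of A is a step of B plus a
   multiple of b. *)
suff H j : E *m B ^+ j *m fr (vfun (h k)) \in U.
  by have := H 0%N; rewrite expr0 mulmx1.
elim: k j => [|k IHk] j.
  by rewrite -h0E mulmxA; apply: Uret.
have -> : fr (vfun (h k.+1)) = B *m fr (vfun (h k)) + h k a *: b.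
  by rewrite forget_root_adj subrK (eq_vfun (hS k)).
rewrite mulmxDr memvD //.
  have H := IHk j.+1; rewrite exprSr in H.
  by rewrite mulmxA -(mulmxA E); exact: H.
rewrite -scalemxAr memvZ //.
have Eb : E *m b = b.
  rewrite /nbr_vec nbr_diag_vfun; apply: eq_vfun => x.
  by case: e; rewrite ?mulr1 ?mulr0.
by rewrite -Eb mulmxA; apply: Uret.
Qed.
End PuncturedGraph.

(** * Harmonic functions on a Cartesian product *)

(** The Laplacian form sum_x sum_(y ~ x) (h x - h y)^2 equals
    2 sum_x h x (D h x - (A h) x), which is 0. *)
Lemma harmonic_edge (R : realType) (T : finType) (e : rel T) (D : R) (h : T -> R) :
  symmetric e -> (forall x, nbr_sum e (fun=> 1) x = D) ->
  (forall x, h x * nbr_sum e h x = D * h x ^+ 2) ->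
  forall x y, e x y -> h x = h y.
Proof.
move=> esym reg harm.
have /eqP : \sum_x \sum_(y | e x y) (h x - h y) ^+ 2 = 0.
  transitivity (\sum_x (nbr_sum e (fun y => h y ^+ 2) x - D * h x ^+ 2)).
    apply: eq_bigr => x _; rewrite -harm.
    transitivity (\sum_(y | e x y) (h x ^+ 2 * 1 + (h y ^+ 2 - 2 * h x * h y))).
      by apply: eq_bigr => y _; lra.
    rewrite big_split /= -mulr_sumr -/(nbr_sum e (fun=> 1) x) reg mulrC -harm.
    rewrite sumrB -mulr_sumr -/(nbr_sum e h x) -/(nbr_sum e (fun y => h y ^+ 2) x).
    lra.
  rewrite sumrB [X in X - _](_ : _ = \sum_x D * h x ^+ 2) ?subrr //.
  rewrite /nbr_sum (exchange_big_dep predT) //=; apply: eq_bigr => y _.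
  rewrite -(reg y) mulr_suml; apply: eq_big => x; first exact: esym.
  by rewrite mul1r.
have sq0 x : 0 <= \sum_(y | e x y) (h x - h y) ^+ 2.
  by rewrite sumr_ge0 // => y _; apply: sqr_ge0.
rewrite psumr_eq0 // => /allP H x y exy; apply/eqP.
have := H x (mem_index_enum x); rewrite /= psumr_eq0 => [/allP/(_ y)|*];
  last exact: sqr_ge0.
by rewrite mem_index_enum exy sqrf_eq0 subr_eq0; apply.
Qed.

(** Every vertex is joined to the root by changing the coordinates one at a time, each
    along a path in its factor. *)
Lemma box_connected_const (R : realType) (l : nat) (F : 'I_l -> finType)
    (e : forall i, rel (F i)) (r : forall i, F i) (h : box_vertex F -> R) :
  (forall i, connected_graph (e i)) ->
  (forall x y, box_edge e x y -> h x = h y) ->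
  forall x, h x = h (box_root r).
Proof.
move=> conn hE.
have step (x : box_vertex F) i (u : F i) : h x = h (box_update x u).
  have /connectP[p] := conn i (x i) u.
  elim: p x => [|v p IHp] x /=.
    move=> _ ->; congr h; apply/ffunP => k.
    have [->|ki] := eqVneq k i; first by rewrite box_update_same.
    by rewrite box_update_other.
  move=> /andP[exv pth] uE; rewrite (hE x (box_update x v)); last first.
    by apply/existsP; exists i; apply/box_stepP; exists v.
  rewrite (IHp (box_update x v)) ?box_update_same //; congr h; apply/ffunP => k.
  have [->|ki] := eqVneq k i; first by rewrite !box_update_same.
  by rewrite !box_update_other.
move=> x.
pose mix (s : seq 'I_l) : box_vertex F := [ffun k => if k \in s then r k else x k].
have mixE s : h x = h (mix s).
  elim: s => [|i s ->]; first by congr h; apply/ffunP => k; rewrite ffunE.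
  rewrite (step _ i (r i)); congr h; apply/ffunP => k.
  have [->|ki] := eqVneq k i; first by rewrite box_update_same ffunE mem_head.
  by rewrite box_update_other // !ffunE inE (negPf ki).
by rewrite (mixE (enum 'I_l)); congr h; apply/ffunP => k; rewrite !ffunE mem_enum.
Qed.

(** The identity asked for by [harmonic_edge] holds at the root because h vanishes there. *)
Lemma box_harmonic_eq0 (R : realType) (l : nat) (F : 'I_l -> finType)
    (e : forall i, rel (F i)) (r : forall i, F i) (d : 'I_l -> nat)
    (h : box_vertex F -> R) :
  (forall i, admissible_factor (e i) (r i) (d i)) ->
  h (box_root r) = 0 ->
  (forall x, x != box_root r ->
    nbr_sum (box_edge e) h x = (\sum_i (d i)%:R) * h x) ->
  forall x, h x = 0.
Proof.
move=> hF h0 harm x; rewrite -h0; apply: (@box_connected_const _ _ _ e).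
  by move=> i; case: (hF i).
have eirr i : irreflexive (e i) by case: (hF i) => -[].
apply: (@harmonic_edge _ _ _ (\sum_i (d i)%:R)).
- move=> y z; apply: eq_existsb => i; rewrite /box_step.
  have [[-> _] _ _ _ _] := hF i; congr (_ && _).
  by apply: eq_forallb => j; congr (_ ==> _); rewrite eq_sym.
- move=> y; rewrite nbr_sum_box //; apply: eq_bigr => i _.
  have [_ _ reg _ _] := hF i.
  by rewrite -(reg (y i)) sumr_const; congr (_ *+ _); apply: eq_card => u; rewrite !inE.
- move=> y; have [->|ya] := eqVneq y (box_root r).
    by rewrite h0 mul0r expr0n mulr0.
  by rewrite harm // expr2 mulrCA.
Qed.

(** * Minkowski sums *)

Section Minkowski.
Variable R : realType.

Lemma minkowski_sumP (J : finType) (A : {set J}) (X : J -> set R) (x : R) :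
  minkowski_sum A X x <->
  exists2 y : J -> R, (forall i, i \in A -> X i (y i)) & x = \sum_(i in A) y i.
Proof.
rewrite /minkowski_sum.
suff H (s : seq J) : uniq s -> forall x,
    (\big[@minkowski_add R/[set 0]]_(i <- s | i \in A) X i) x <->
    exists2 y : J -> R, (forall i, i \in s -> i \in A -> X i (y i)) &
      x = \sum_(i <- s | i \in A) y i.
  rewrite (H _ (index_enum_uniq J)); split=> -[y Xy ->]; exists y => //.
    by move=> i; apply: Xy; rewrite mem_index_enum.
  by move=> i _; apply: Xy.
elim: s => [_|j s IHs /= /andP[js us]] {}x.
  rewrite big_nil; split=> [->|[y _ ->]]; last by rewrite big_nil.
  by exists (fun=> 0) => //; rewrite big_nil.
rewrite big_cons; case: ifPn => jA; last first.
  rewrite IHs //; split=> -[y Xy ->]; exists y; rewrite ?big_cons ?(negPf jA) //.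
    move=> i; rewrite inE => /predU1P[->|]; last exact: Xy.
    by rewrite (negPf jA).
  by move=> i si; apply: Xy; rewrite inE si orbT.
split=> [[u Xu [v /(IHs us)[y Xy ->] <-]]|[y Xy ->]].
  exists (fun i => if i == j then u else y i).
    move=> i; rewrite inE; case: eqVneq => [-> //|_ /=]; exact: Xy.
  rewrite big_cons jA eqxx; congr (_ + _); rewrite big_seq_cond [RHS]big_seq_cond.
  apply: eq_bigr => i /andP[si _]; case: eqVneq => // ij.
  by rewrite -ij si in js.
rewrite big_cons jA; exists (y j); first by apply: Xy => //; exact: mem_head.
exists (\sum_(i <- s | i \in A) y i) => //; apply/IHs => //.
by exists y => // i si; apply: Xy; rewrite inE si orbT.
Qed.
End Minkowski.

(** * The boundary-return space and the local module of a product *)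

Section Assembly.
Variables (R : realType) (l : nat) (F : 'I_l -> finType).
Variables (e : forall i, rel (F i)) (r : forall i, F i) (d : 'I_l -> nat).
Arguments e : clear implicits.
Hypothesis hF : forall i, admissible_factor (e i) (r i) (d i).
Variables (J : finType) (th : J -> R).
Hypothesis th_inj : injective th.
Hypothesis th_res : forall i u,
  \sum_s local_comp (e i) (r i) (th s) u = (u == r i)%:R.
Hypothesis th_spec : forall i x, local_spectrum R (e i) (r i) x ->
  exists s, th s = x.

Local Notation box := (box_vertex F).
Local Notation a := (box_root r).
Local Notation om := (factor_weight e r th).
Local Notation dR := (fun i => (d i)%:R : R).
Local Notation jvec := (joint_vec e r th).
Local Notation lam := (label_value th).
Local Notation wt := (label_weight om).
Local Notation ret := (return_term th om dR).
Local Notation fr := (@forget_root R box a).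
Local Notation B := (adj_punctured R (box_edge e) a).
Local Notation b := (nbr_vec R (box_edge e) a).
Local Notation E := (nbr_diag R (box_edge e) a).
Local Notation dir := (dir_vec R e r).
Local Notation label := {ffun 'I_l -> J}.

Let esymm i : symmetric (e i).
Proof. by case: (hF i) => -[]. Qed.
Let eirr i : irreflexive (e i).
Proof. by case: (hF i) => -[]. Qed.
Lemma box_edge_sym : symmetric (box_edge e).
Proof.
move=> y z; apply: eq_existsb => i; rewrite /box_step esymm; congr (_ && _).
by apply: eq_forallb => j; congr (_ ==> _); rewrite eq_sym.
Qed.

Lemma label_weight_ge0 f : 0 <= wt f.
Proof. by apply: prodr_ge0 => i _; apply: factor_weight_ge0. Qed.

Lemma joint_vec_eq0 f x : wt f = 0 -> jvec f x = 0.
Proof.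
move=> /eqP/prodf_eq0[i _ /eqP oi0]; rewrite /joint_vec (bigD1 i) //=.
by rewrite {1}/factor_comp local_comp_eq0 // mul0r.
Qed.

Lemma local_PhiE i : local_Phi (e i) (r i) = mgf th om i.
Proof.
apply/funext => z; rewrite /local_Phi (fsbig_fwiden (codom th)).
- by rewrite /codom big_map big_enum.
- by move=> x /th_spec[s <-] /=; apply: codom_f.
- by rewrite map_inj_uniq ?enum_uniq.
- move=> x [_ /= Nx]; have [->|] := eqVneq (local_weight R (e i) (r i) x) 0.
    by rewrite mul0r.
  by move/(local_spectrumP (e i) (r i)) => /Nx.
Qed.

Lemma local_etaE i : local_eta R (e i) (r i) (d i) = log_slope th om dR i.
Proof. by apply/funext => z; rewrite /local_eta local_PhiE. Qed.

Lemma degree_local_Phi i :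
  derive1 (derive1 (@local_Phi R _ (e i) (r i))) 0 = (d i)%:R.
Proof.
rewrite local_PhiE /mgf !derive1_expsum -(factor_weight_mean2 hF th_res).
apply: eq_bigr => s _; rewrite mul0r expR0 mulr1.
by rewrite mulrA mulrC expr2.
Qed.

(** The function p(A) (c0 e_a + sum_i al_i A_i e_a), written in the joint eigenvectors. *)
Definition spectral_vec (c0 : R) (al : 'I_l -> R) (p : R -> R) (x : box) : R :=
  \sum_f jvec f x * (c0 + \sum_i al i * th (f i)) * p (lam f).

Lemma spectral_vec_adj c0 al p :
  nbr_sum (box_edge e) (spectral_vec c0 al p) =1 spectral_vec c0 al (fun y => y * p y).
Proof.
move=> x; rewrite /nbr_sum /spectral_vec exchange_big /=; apply: eq_bigr => f _.
rewrite -!mulr_suml -/(nbr_sum (box_edge e) (jvec f) x) (joint_vec_adj hF).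
set S := _ + _; lra.
Qed.

Lemma spectral_vec_boundary c0 al p : E *m fr (vfun (spectral_vec c0 al p)) =
  \sum_i (\sum_f ret i c0 al f * p (lam f)) *: dir i.
Proof.
rewrite forget_root_vfun nbr_diag_vfun; apply/colP => k; rewrite mxE summxE.
under [RHS]eq_bigr do rewrite !mxE.
move: (enum_val k) => x; rewrite box_edgeE // mulr_suml; apply: eq_bigr => i _.
case: (boolP (box_step e i a (val x))) => step; last by rewrite mul0r mulr0.
rewrite mul1r mulr1; apply: eq_bigr => f _.
by rewrite (joint_vec_boundary hF th_inj th_res f step) /return_term.
Qed.

Lemma spectral_vec_fr1 c0 al :
  fr (vfun (spectral_vec c0 al (fun=> 1))) = \sum_i al i *: dir i.
Proof.
rewrite forget_root_vfun; apply/colP => k; rewrite mxE summxE.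
under [RHS]eq_bigr do rewrite !mxE.
move: (enum_val k) => x; rewrite /spectral_vec.
transitivity (c0 * \sum_f jvec f (val x) +
    \sum_i al i * \sum_(f : label) th (f i) * jvec f (val x)).
  rewrite mulr_sumr; under [X in _ + X]eq_bigr do rewrite mulr_sumr.
  rewrite exchange_big -big_split; apply: eq_bigr => f _ /=.
  rewrite mulr1 mulrDr (mulrC _ c0) mulr_sumr; congr (_ + _).
  by apply: eq_bigr => i _; rewrite mulrC mulrA.
rewrite (sum_joint_vec th_res) (negPf (valP x)) mulr0 add0r; apply: eq_bigr => i _.
by rewrite (sum_th_joint_vec hF th_res).
Qed.

Lemma spectral_vec_root : vfun (spectral_vec 1 (fun=> 0) (fun=> 1)) = basis_vec R a.
Proof.
apply: eq_vfun => x; rewrite /spectral_vec -(sum_joint_vec th_res).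
by apply: eq_bigr => f _; rewrite mulr1 big1 ?addr0 ?mulr1 // => i _; rewrite mul0r.
Qed.

Lemma sum_dir : \sum_i dir i = b.
Proof.
apply/colP => k; rewrite summxE mxE box_edgeE //; apply: eq_bigr => i _.
by rewrite mxE.
Qed.

Lemma nbr_diag_dir i : E *m dir i = dir i.
Proof.
rewrite /dir_vec nbr_diag_vfun; apply: eq_vfun => x; rewrite -natrM mulnb.
congr (_%:R); case step: box_step; rewrite ?andbF // andbT.
by congr nat_of_bool; apply/existsP; exists i.
Qed.

Variables (t : nat) (I : 'I_t -> {set 'I_l}).
Hypothesis I_inj : injective I.
Hypothesis I_classes : [set I g | g : 'I_t]%SET = boundary_classes R e r d.

Local Notation T := (fun g : 'I_t => class_spectrum R e r (I g)).
Local Notation etaE := (log_slope th om dR).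

Let rel_eta (i j : 'I_l) := `[< forall z : R, local_eta R (e i) (r i) (d i) z
                         = local_eta R (e j) (r j) (d j) z >].

Let rel_etaP i j : reflect (etaE i =1 etaE j) (rel_eta i j).
Proof. by apply: (iffP (asboolP _)) => H z; have := H z; rewrite !local_etaE. Qed.

Let eqv_eta : {in [set: 'I_l]%SET & &, equivalence_rel rel_eta}.
Proof.
move=> i j k _ _ _; split=> [|/rel_etaP ij]; first exact/rel_etaP.
by apply/rel_etaP/rel_etaP => H z; rewrite -H ij.
Qed.

Let class_mem g : I g \in boundary_classes R e r d.
Proof. by rewrite -I_classes imset_f. Qed.

Let class_partition : finset.partition (boundary_classes R e r d) [set: 'I_l]%SET.
Proof. exact: equivalence_partitionP eqv_eta. Qed.

Let class_pblock g i : i \in I g ->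
  finset.pblock (boundary_classes R e r d) i = I g.
Proof.
by move=> ig; case/and3P: class_partition => _ tI _; apply: finset.def_pblock ig.
Qed.

Lemma classP g i : i \in I g -> forall j, (j \in I g) <-> (etaE i =1 etaE j).
Proof.
move=> ig j; rewrite -(class_pblock ig).
by rewrite (pblock_equivalence_partition eqv_eta) ?inE //; split=> /rel_etaP.
Qed.

Lemma class_cover i : exists g, i \in I g.
Proof.
case/and3P: class_partition => /eqP cov _ _.
have icov : i \in finset.cover (boundary_classes R e r d) by rewrite cov inE.
have := finset.pblock_mem icov; rewrite -{2}I_classes => /imsetP[g _ gE].
by exists g; rewrite -gE finset.mem_pblock.
Qed.

Lemma class_unique i g g' : i \in I g -> i \in I g' -> g = g'.
Proof. by move=> ig ig'; apply: I_inj;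
  rewrite -(class_pblock ig) (class_pblock ig'). Qed.

Lemma class_neq0 g : exists i, i \in I g.
Proof.
apply/set0Pn; case/and3P: class_partition => _ _; apply: contraNneq => <-.
exact: class_mem.
Qed.

Lemma sum_class (V : nmodType) (h : 'I_l -> V) :
  \sum_g \sum_(i in I g) h i = \sum_i h i.
Proof.
rewrite (exchange_big_dep predT) //=; apply: eq_bigr => i _.
have [g ig] := class_cover i.
rewrite (big_pred1 g) // => g' /=; apply/idP/eqP => [ig'|-> //].
exact: class_unique ig' ig.
Qed.

Definition class_span := <<[seq class_vec R e r (I g) | g <- enum 'I_t]>>%VS.

Lemma class_vec_span g : class_vec R e r (I g) \in class_span.
Proof. by apply/memv_span/map_f; rewrite mem_enum. Qed.

Lemma class_sum_span (k : 'I_l -> R) :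
  (forall i j, etaE i =1 etaE j -> k i = k j) ->
  \sum_i k i *: dir i \in class_span.
Proof.
move=> kc; rewrite -sum_class memv_suml // => g _.
have [i0 i0g] := class_neq0 g.
suff -> : \sum_(i in I g) k i *: dir i = k i0 *: class_vec R e r (I g).
  by rewrite memvZ ?class_vec_span.
rewrite scaler_sumr; apply: eq_bigr => i ig; congr (_ *: _).
by apply: kc; apply/(classP ig).
Qed.

(** Coefficients c_g on the classes, pulled back to the indices of the factors. *)
Definition class_fun (c : 'I_t -> R) (i : 'I_l) : R := \sum_g (i \in I g)%:R * c g.

Lemma class_funE c g i : i \in I g -> class_fun c i = c g.
Proof.
move=> ig; rewrite /class_fun (bigD1 g) //= ig mul1r big1 ?addr0 // => g' g'g.
have [ig'|] := boolP (i \in I g'); last by rewrite mul0r.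
by rewrite (class_unique ig' ig) eqxx in g'g.
Qed.

Lemma class_fun_const c i j : etaE i =1 etaE j -> class_fun c i = class_fun c j.
Proof.
have [g ig] := class_cover i => /(classP ig) jg.
by rewrite !(class_funE _ (g := g)).
Qed.

Lemma spectral_vec_boundary_span c0 c p :
  E *m fr (vfun (spectral_vec c0 (class_fun c) p)) \in class_span.
Proof.
rewrite spectral_vec_boundary class_sum_span // => i j ij.
apply: return_term_class ij (class_fun_const c ij).
- exact: factor_weight_ge0.
- by move=> k; apply: factor_weight_sum th_res k.
Qed.

Lemma class_dir_sum c :
  \sum_i class_fun c i *: dir i = \sum_g c g *: class_vec R e r (I g).
Proof.
rewrite -sum_class; apply: eq_bigr => g _; rewrite scaler_sumr.
by apply: eq_bigr => i ig; rewrite (class_funE c ig).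
Qed.

(** The coordinate families of the vectors of U satisfy the hypotheses of
    [class_indicator], by [boundary_words]. *)
Lemma class_vecs_min (U : {vspace 'cV[R]_#|punctured a|}) :
  b \in U -> (forall k v, v \in U -> return_mx R (box_edge e) a k *m v \in U) ->
  forall g, class_vec R e r (I g) \in U.
Proof.
move=> bU Uret g; have [i ig] := class_neq0 g.
pose P (al : 'I_l -> R) : Prop := \sum_i al i *: dir i \in U.
have Pfr al : P al <-> fr (vfun (spectral_vec 0 al
  (fun=> 1))) \in U by rewrite spectral_vec_fr1.
have : P (fun j => `[< etaE i =1 etaE j >]%:R).
  refine (@class_indicator R l J th om dR (factor_weight_ge0 e r th)
    (factor_weight_sum th_res)
    (factor_weight_mean hF th_res) P _ _ _ i).
  - by rewrite /P; under eq_bigr do rewrite scale1r; rewrite sum_dir.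
  - move=> c al be Pal Pbe; rewrite /P; under eq_bigr do rewrite scalerDl -scalerA.
    by rewrite big_split -scaler_sumr /= memvD ?memvZ.
  - move=> k al /Pfr Pal; rewrite /P -(spectral_vec_boundary 0 al (fun y => y ^+ k)).
    apply: (@boundary_words _ _ _ _ box_edge_sym U
       (fun k => spectral_vec 0 al (fun y => y ^+ k)) bU Uret).
    + by move=> m x; rewrite spectral_vec_adj; apply: eq_bigr => f _; rewrite exprS.
    + by rewrite (eq_vfun (h2 := spectral_vec 0 al (fun=> 1))).
    + rewrite (eq_vfun (h2 := spectral_vec 0 al
      (fun=> 1))) // spectral_vec_fr1 mulmx_sumr.
      by apply: eq_bigr => j _; rewrite -scalemxAr nbr_diag_dir.
rewrite /P; suff -> : \sum_j `[< etaE i =1 etaE j >]%:R *: dir j =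
  class_vec R e r (I g) by [].
rewrite /class_vec [RHS]big_mkcond; apply: eq_bigr => j _.
case: ifPn => [/(classP ig)/asboolP ->|jg]; first by rewrite scale1r.
case: asboolP => [ij|]; last by rewrite scale0r.
by case/negP: jg; apply/(classP ig).
Qed.

Lemma nbr_diag_span v : v \in class_span -> E *m v = v.
Proof.
suff /subvP H : (class_span <= lker (linfun (mulmx (E - 1%:M)) : 'End(_)))%VS.
  move=> /H; rewrite memv_ker lfunE /= mulmxBl mul1mx subr_eq0.
  by move/eqP.
apply/span_subvP => _ /mapP[g _ ->]; rewrite memv_ker lfunE /= mulmxBl mul1mx.
rewrite subr_eq0 mulmx_sumr; apply/eqP/eq_bigr => i _; exact: nbr_diag_dir.
Qed.

Lemma nbr_vec_span : b \in class_span.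
Proof.
rewrite -sum_dir; under eq_bigr do rewrite -[dir _]scale1r.
exact: class_sum_span.
Qed.

(** The tuple y of class sums of a labelling. *)
Definition class_values (f : label) : 'rV[R]_t := \row_g \sum_(i in I g) th (f i).

Lemma class_values_sum f : \sum_g class_values f 0 g = lam f.
Proof.
transitivity (\sum_i th (f i)) => //.
by rewrite -sum_class; apply: eq_bigr => g _; rewrite mxE.
Qed.

Lemma class_values_class f c : \sum_g class_values f 0 g * c g =
  \sum_i class_fun c i * th (f i).
Proof.
rewrite -sum_class; apply: eq_bigr => g _; rewrite mxE mulr_suml.
by apply: eq_bigr => i ig; rewrite (class_funE c ig) mulrC.
Qed.

Lemma factor_weight_spec i s : om i s != 0 <-> local_spectrum R (e i) (r i) (th s).
Proof. by split=> /local_spectrumP. Qed.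

(** Every element of T_1 x ... x T_t comes from a labelling of nonzero weight: choose a
    summand in each class sum, and use that the classes partition the factors. *)
Lemma class_spectrumP (y : 'rV[R]_t) :
  (forall g, T g (y 0 g)) <-> exists2 f, wt f != 0 & class_values f = y.
Proof.
split=> [Ty|[f wf <-] g]; last first.
  apply/minkowski_sumP; exists (fun i => th (f i)); last by rewrite mxE.
  by move=> i _; apply/factor_weight_spec; move/prodf_neq0: wf; apply.
have /fin_all_exists2 [u Tu yu] : forall g, exists2 u : 'I_l -> R,
    (forall i, i \in I g -> local_spectrum R (e i) (r i) (u i)) &
    y 0 g = \sum_(i in I g) u i.
  by move=> g; have /minkowski_sumP := Ty g.
have /fin_all_exists [s sP] : forall i, exists s, om i s != 0 /\
    forall g, i \in I g -> th s = u g i.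
  move=> i; have [g ig] := class_cover i.
  have [s sE] := th_spec (Tu g i ig).
  exists s; split=> [|g' ig']; last by rewrite (class_unique ig' ig).
  by apply/factor_weight_spec; rewrite sE; apply: Tu.
exists [ffun i => s i].
  by apply/prodf_neq0 => i _; rewrite ffunE; case: (sP i).
apply/rowP => g; rewrite mxE yu; apply: eq_bigr => i ig; rewrite ffunE.
by case: (sP i) => _; apply.
Qed.

Lemma fiberP x (y : 'rV[R]_t) :
  fiber T x y <-> exists f, [/\ wt f != 0, class_values f = y & lam f = x].
Proof.
split=> [[/class_spectrumP[f wf yf] yx]|[f [wf <- <-]]].
  by exists f; split=> //; rewrite -class_values_sum yf.
by split; [apply/class_spectrumP; exists f | apply: class_values_sum].
Qed.

Lemma mem_fiber_seq x y :
  (y \in fiber_seq T x) = `[< fiber T x y >].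
Proof.
have fin : finite_set (fiber T x).
  apply: (@sub_finite_set _ _ [set` codom class_values]); last exact: finite_seq.
  by move=> z /fiberP[f [_ <- _]] /=; apply: codom_f.
have -> : (y \in fiber_seq T x) = (y \in fiber T x) := in_fset_set fin y.
by apply/idP/asboolP; [exact: set_mem | exact: mem_set].
Qed.

Lemma fiber_seq_uniq x : uniq (fiber_seq T x).
Proof. exact: finmap.fset_uniq. Qed.

Lemma class_values_fiber x f : wt f != 0 ->
  (class_values f \in fiber_seq T x) = (lam f == x).
Proof.
move=> wf; rewrite mem_fiber_seq; apply/asboolP/eqP => [[_ <-]|fx].
  by rewrite class_values_sum.
by apply/fiberP; exists f.
Qed.

(** The vector w_y. *)
Definition class_vec_at (y : 'rV[R]_t) (x : box) : R :=
  \sum_(f | class_values f == y) jvec f x.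

Definition class_vec_mx x : 'M[R]_(#|box|, size (fiber_seq T x)) :=
  \matrix_(i, k) class_vec_at (fiber_seq T x)`_k (enum_val i).

(** The product W_lam R_lam c: the row (1, y) of R_lam evaluates c at y, and labellings
    with class sums in the fiber are those of eigenvalue lam, up to labellings of
    weight 0, whose vector is 0. *)
Lemma class_vec_mx_fiber x (c : 'cV[R]_(1 + t)) :
  class_vec_mx x *m (fiber_mx T x *m c) =
  vfun (spectral_vec (usubmx c 0 0) (class_fun (fun g => dsubmx c g 0)) (fun y =>
    (y == x)%:R)).
Proof.
pose G (y : 'rV[R]_t) := usubmx c 0 0 + \sum_g y 0 g * dsubmx c g 0.
have fibG j : (fiber_mx T x *m c) j 0 = G (fiber_seq T x)`_j.
  have -> : (fiber_mx T x *m c) j 0 = (row j (fiber_mx T x) *m c) 0 0.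
    by rewrite -row_mul [RHS]mxE.
  by rewrite /fiber_mx rowK -[in LHS](vsubmxK c) mul_row_col mul1mx mxE;
    congr (_ + _); rewrite mxE.
apply/colP => k; rewrite [LHS]mxE [RHS]mxE; move def_v: (enum_val k) => v.
transitivity (\sum_(j < size (fiber_seq T x))
   class_vec_at (fiber_seq T x)`_j v * G (fiber_seq T x)`_j).
  by apply: eq_bigr => j _; rewrite fibG mxE def_v.
rewrite -(big_mkord predT (fun j => class_vec_at (fiber_seq T x)`_j v *
  G (fiber_seq T x)`_j)).
rewrite -(big_nth 0 predT (fun y => class_vec_at y v * G y)).
transitivity (\sum_(y <- fiber_seq T x) \sum_(f | class_values f == y) jvec f v *
  G (class_values f)).
  apply: eq_bigr => y _; rewrite mulr_suml.
  by apply: eq_bigr => f /eqP ->.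
rewrite (exchange_big_dep predT) //=; apply: eq_bigr => f _.
have [wf|wf] := eqVneq (wt f) 0.
  by rewrite (joint_vec_eq0 v wf) !mul0r big1 // => y _; rewrite mul0r.
rewrite /G class_values_class /= -(class_values_fiber x wf);
  case: (boolP (_ \in _)) => [fin|fnin].
  rewrite big_mkcond (bigD1_seq (class_values f)) ?fiber_seq_uniq //= eqxx mulr1.
  by rewrite [X in _ + X = _]big1 ?addr0 // => y; rewrite eq_sym => /negPf ->.
rewrite mulr0 big1_seq // => y /andP[/eqP yf ys]; by rewrite -yf (negPf fnin) in ys.
Qed.

Lemma class_vec_at_orth y y' : y != y' ->
  \sum_x class_vec_at y x * class_vec_at y' x = 0.
Proof.
move=> yy; rewrite /class_vec_at; under eq_bigr do rewrite mulr_suml.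
rewrite exchange_big big1 //= => f /eqP fy.
under eq_bigr do rewrite mulr_sumr; rewrite exchange_big big1 //= => f' /eqP fy'.
apply: (joint_vec_orth hF th_inj); apply: contraNneq yy => ff.
by rewrite -fy -fy' ff.
Qed.

(** The value of w_y at the root is a sum of weights, not all of them 0. *)
Lemma class_vec_at_gt0 x y : y \in fiber_seq T x -> 0 < class_vec_at y a.
Proof.
rewrite mem_fiber_seq => /asboolP/fiberP[f [wf yf _]].
rewrite /class_vec_at; under eq_bigr do rewrite joint_vec_root.
rewrite (bigD1 f) ?yf //= ltr_pwDl ?lt_def ?wf ?label_weight_ge0 //.
by rewrite sumr_ge0 // => f' _; apply: label_weight_ge0.
Qed.

(** The columns w_y of W_lam are orthogonal and nonzero, so W_lam is injective. *)
Lemma rank_class_vec_mx x : \rank (class_vec_mx x *m fiber_mx T x) =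
  \rank (fiber_mx T x).
Proof.
rewrite -mxrank_tr trmx_mul mxrankMfree ?mxrank_tr //.
apply: inj_row_free => v vW; apply/rowP => k; rewrite mxE.
pose y := (fiber_seq T x)`_k.
have ys : y \in fiber_seq T x by apply: mem_nth.
have v0 i : \sum_j v 0 j * class_vec_at (fiber_seq T x)`_j i = 0.
  have /matrixP/(_ 0 (enum_rank i)) := vW; rewrite !mxE => vi.
  rewrite -[RHS]vi; apply: eq_bigr => j _; by rewrite !mxE enum_rankK.
have : v 0 k * \sum_i class_vec_at y i * class_vec_at y i = 0.
  transitivity (\sum_i (\sum_j v 0 j * class_vec_at (fiber_seq T x)`_j i) *
    class_vec_at y i).
    under [RHS]eq_bigr do rewrite mulr_suml.
    rewrite exchange_big /= (bigD1 k) //= [X in _ + X]big1 ?addr0.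
      by rewrite mulr_sumr; apply: eq_bigr => i _; rewrite mulrA.
    move=> j jk; under eq_bigr do rewrite -mulrA.
    rewrite -mulr_sumr class_vec_at_orth ?mulr0 // nth_uniq ?fiber_seq_uniq //.
  by rewrite big1 // => i _; rewrite v0 mul0r.
move/eqP; rewrite mulf_eq0 => /orP[/eqP //|].
rewrite psumr_eq0 => [/allP/(_ a (mem_index_enum a))|i _]; last first.
  by rewrite -expr2 sqr_ge0.
by rewrite /= mulf_eq0 orbb gt_eqF // (class_vec_at_gt0 ys).
Qed.

(** The projection of Q to the eigenspace of A at [x]. *)
Definition root_eigenspace x : {vspace 'cV[R]_#|box|} :=
  limg (linfun (mulmx (class_vec_mx x *m fiber_mx T x)) : 'Hom('cV[R]_(1 +
    t), 'cV[R]_#|box|)).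

Lemma dim_root_eigenspace x : \dim (root_eigenspace x) = \rank (fiber_mx T x).
Proof. by rewrite dim_limg_mulmx rank_class_vec_mx. Qed.

Lemma root_eigenspaceP x v : v \in root_eigenspace x <-> exists c0 c,
  v = vfun (spectral_vec c0 (class_fun c) (fun y => (y == x)%:R)).
Proof.
split=> [/memv_imgP[c _ ->]|[c0 [c ->]]].
  by rewrite lfunE /= -mulmxA class_vec_mx_fiber; do 2!eexists.
pose u : 'cV[R]_(1 + t) := col_mx (const_mx c0) (\col_g c g).
have := memv_img (linfun (mulmx (class_vec_mx x *m fiber_mx T x)) : 'Hom('cV[R]_(1 +
  t), 'cV[R]_#|box|)) (memvf u).
rewrite lfunE /= -mulmxA class_vec_mx_fiber col_mxKu col_mxKd mxE.
by rewrite (_ : (fun g => _) = c) //; apply/funext => g; rewrite mxE.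
Qed.

Definition joint_values : seq R := undup (codom (fun f : label => lam f)).
(** The A-invariant space Q generated by e_a and the c_g. *)
Definition root_space : {vspace 'cV[R]_#|box|} :=
  (\sum_(k < size joint_values) root_eigenspace joint_values`_k)%VS.

Lemma root_eigenspace_adj x v : v \in root_eigenspace x ->
  adjmx R (box_edge e) *m v = x *: v.
Proof.
move=> /root_eigenspaceP[c0 [c ->]];
  rewrite adjmx_vfun (eq_vfun (spectral_vec_adj _ _ _)).
apply/colP => k; rewrite !mxE mulr_sumr; apply: eq_bigr => f _.
by have [->|] := eqVneq (lam f) x; rewrite ?mulr0 // mulrCA.
Qed.

Lemma dim_root_space : \dim root_space =
  (\sum_(k < size joint_values) \rank (fiber_mx T joint_values`_k))%N.
Proof.
rewrite (@directv_eigen _ _ _ (adjmx R (box_edge e)) (fun k => joint_values`_k)).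
- by apply: eq_bigr => k _; apply: dim_root_eigenspace.
- by move=> i j /eqP; rewrite nth_uniq ?undup_uniq // => /eqP/val_inj.
- by move=> k v; apply: root_eigenspace_adj.
Qed.

Lemma spectral_vec_root_space c0 c p : vfun (spectral_vec c0
  (class_fun c) p) \in root_space.
Proof.
have -> : vfun (spectral_vec c0 (class_fun c) p) =
  \sum_(k < size joint_values) p joint_values`_k *:
    vfun (spectral_vec c0 (class_fun c) (fun y => (y == joint_values`_k)%:R)).
  apply/colP => j; rewrite mxE summxE; under [RHS]eq_bigr do rewrite !mxE mulr_sumr.
  rewrite exchange_big; apply: eq_bigr => f _ /=.
  have fl : lam f \in joint_values by rewrite mem_undup (codom_f
    (fun f : label => lam f)).
  have fi : (index (lam f) joint_values < size joint_values)%N by rewrite index_mem.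
  rewrite (bigD1 (Ordinal fi)) //= nth_index // eqxx mulr1 mulrC [X in _ =
    _ + X]big1 ?addr0 //.
  move=> k kf; case: eqVneq => [fE|_]; last by rewrite !mulr0.
  case/eqP: kf; apply: val_inj; rewrite /= fE index_uniq ?undup_uniq //.
by apply: memv_sumr => k _; rewrite memvZ //; apply/root_eigenspaceP; exists c0, c.
Qed.

Lemma root_space_sub (U : {vspace 'cV[R]_#|box|}) :
  (forall c0 c p, vfun (spectral_vec c0 (class_fun c) p) \in U) -> (root_space <= U)%VS.
Proof.
move=> H; apply/subv_sumP => k _; apply/subvP => v /root_eigenspaceP[c0 [c ->]];
  exact: H.
Qed.


Let frl : 'Hom('cV[R]_#|box|, 'cV[R]_#|punctured a|) := linfun fr.

Definition punctured_space : {vspace 'cV[R]_#|punctured a|} := (frl @: root_space)%VS.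

Lemma spectral_vec_punctured_space c0 c p : fr (vfun (spectral_vec c0
  (class_fun c) p)) \in punctured_space.
Proof. by have := memv_img frl (spectral_vec_root_space c0 c p); rewrite lfunE. Qed.

(** The vectors p(A) (c_0 e_a + sum_g c_g A_g e_a), A_g being the sum of the A_i over the
    class, span Q, so a linear condition may be checked on them. *)
Lemma punctured_space_sub (U : {vspace 'cV[R]_#|punctured a|}) :
  (forall c0 c p, fr (vfun (spectral_vec c0 (class_fun c) p)) \in U) ->
    (punctured_space <= U)%VS.
Proof.
move=> H; have : (root_space <= frl @^-1: U)%VS.
  by apply: root_space_sub => c0 c p; rewrite -memv_preim lfunE; apply: H.
by move=> /subvP QU; apply/subvP => _ /memv_imgP[q /QU qU ->]; rewrite memv_preim.
Qed.

Lemma basis_root_space : basis_vec R a \in root_space.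
Proof.
rewrite -spectral_vec_root (_ : (fun=> 0) = class_fun (fun=> 0));
  first exact: spectral_vec_root_space.
by apply/funext => i; rewrite /class_fun big1 // => g _; rewrite mulr0.
Qed.

(** Only the multiples of e_a become 0 when the root is forgotten. *)
Lemma dim_punctured_space : (\dim punctured_space).+1 = \dim root_space.
Proof.
rewrite -(limg_ker_dim frl root_space) -addn1 addnC; congr (_ + _)%N.
have -> : (root_space :&: lker frl)%VS = <[basis_vec R a]>%VS.
  apply: subv_anti; apply/andP; split.
    apply/subvP => v; rewrite memv_cap memv_ker lfunE /= => /andP[_
      /eqP/forget_root_eq0 ->].
    by rewrite memvZ ?memv_line.
  rewrite -memvE memv_cap basis_root_space memv_ker lfunE /= forget_root_vfun.
  apply/eqP/colP => k; rewrite !mxE; have := valP (enum_val k).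
  by move=> /negPf ->.
rewrite dim_vline; suff -> : basis_vec R a != 0 by [].
apply/eqP => /(congr1 (fun v => coord_at v a)); rewrite coord_vfun eqxx /coord_at mxE.
by move/eqP; rewrite oner_eq0.
Qed.

Lemma class_span_punctured_space : (class_span <= punctured_space)%VS.
Proof.
apply/span_subvP => _ /mapP[g _ ->].
have := spectral_vec_punctured_space 0 (fun g' => (g' == g)%:R) (fun=> 1).
rewrite spectral_vec_fr1 class_dir_sum (bigD1 g) //= eqxx scale1r big1 ?addr0 //.
by move=> g' /negPf ->; rewrite scale0r.
Qed.

(** This is [return_term_class] in disguise: cutting off outside N(a) leaves class
    constant coefficients. *)
Lemma punctured_space_boundary v : v \in punctured_space -> E *m v \in class_span.
Proof.
suff /subvP H : (punctured_space <= linfun (mulmx E) @^-1: class_span)%VS.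
  by move=> /H; rewrite -memv_preim lfunE.
by apply: punctured_space_sub => c0 c p; rewrite -memv_preim lfunE;
  apply: spectral_vec_boundary_span.
Qed.

Lemma punctured_space_adj v : v \in punctured_space -> B *m v \in punctured_space.
Proof.
suff /subvP H : (punctured_space <= linfun (mulmx B) @^-1: punctured_space)%VS.
  by move=> /H; rewrite -memv_preim lfunE.
apply: punctured_space_sub => c0 c p; rewrite -memv_preim lfunE /= forget_root_adj;
  last exact: box_edge_sym.
rewrite (eq_vfun (spectral_vec_adj _ _ _)) memvB ?spectral_vec_punctured_space //
  memvZ //.
exact: (subvP class_span_punctured_space) nbr_vec_span.
Qed.

Lemma punctured_space_return k v : v \in class_span ->
  return_mx R (box_edge e) a k *m v \in class_span.
Proof.
move=> vC; rewrite /return_mx -!mulmxA; apply: punctured_space_boundary.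
have : E *m v \in punctured_space.
  by rewrite nbr_diag_span //; apply: (subvP class_span_punctured_space).
elim: k (E *m v) => [|k IHk] w wP; first by rewrite expr0 mul1mx.
by rewrite exprSr -mulmxA; apply: IHk; apply: punctured_space_adj.
Qed.

Lemma nbr_sum_const x : nbr_sum (box_edge e) (fun=> 1) x = \sum_i (d i)%:R :> R.
Proof.
rewrite nbr_sum_box //; apply: eq_bigr => i _; have [_ _ reg _ _] := hF i.
by rewrite -(reg (x i)) sumr_const; congr (_ *+ _); apply: eq_card => u; rewrite !inE.
Qed.

Lemma ones_fr : ones_vec R a = fr (vfun (fun=> 1)).
Proof. by rewrite forget_root_vfun; apply/colP => k; rewrite !mxE. Qed.

(** D - B is injective by [box_harmonic_eq0] and preserves the space, which is finite
    dimensional, so b has a preimage there; the ones are the preimage of b. *)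
Lemma ones_punctured_space : ones_vec R a \in punctured_space.
Proof.
pose D : R := \sum_i (d i)%:R.
pose f : 'End('cV[R]_#|punctured a|) := linfun (mulmx (D%:M - B)).
have fE v : f v = D *: v - B *m v by rewrite lfunE /= mulmxBl mul_scalar_mx.
have f0 v : f v = 0 -> v = 0.
  rewrite fE => /eqP; rewrite subr_eq0 => /eqP Bv.
  pose h (x : box) : R := if insub x is Some y then coord_at v (y : punctured a) else 0.
  have vh : v = fr (vfun h).
    rewrite forget_root_vfun -[LHS]vfun_coord; apply: eq_vfun => x.
    by rewrite /h valK.
  have ha : h a = 0 by rewrite /h insubN // negbK.
  have h0 : forall x, h x = 0.
    apply: (box_harmonic_eq0 hF ha) => x xa.
    have := forget_root_adj a box_edge_sym h;
      rewrite -vh -Bv ha scale0r subr0 vh !forget_root_vfun.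
    move/(congr1 (fun w => coord_at w (Sub x xa : punctured a))).
    by rewrite coord_vfun SubK /coord_at !mxE enum_rankK SubK => <-.
  by rewrite vh forget_root_vfun; apply/colP => k; rewrite !mxE h0.
have kerf : lker f == 0%VS.
  by rewrite -subv0; apply/subvP => v; rewrite memv_ker memv0 => /eqP/f0 ->.
have fP : (f @: punctured_space)%VS = punctured_space.
  apply/eqP; rewrite eqEdim limg_dim_eq ?(eqP kerf) ?capv0 // leqnn andbT.
  apply/subvP => _ /memv_imgP[v vP ->].
  by rewrite fE memvB ?memvZ ?punctured_space_adj.
have : b \in (f @: punctured_space)%VS.
  by rewrite fP; apply: (subvP class_span_punctured_space) nbr_vec_span.
case/memv_imgP => v vP bE; suff -> : ones_vec R a = v by [].
apply: (lker0P kerf); rewrite -bE fE ones_fr forget_root_adj; last exact: box_edge_sym.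
rewrite scale1r (eq_vfun nbr_sum_const) (_ : fr (vfun (fun=> \sum_i (d i)%:R)) =
  D *: fr (vfun (fun=> 1))).
  by rewrite opprB addrCA subrr addr0.
by rewrite -linearZ /=; congr fr; apply/colP => k; rewrite !mxE mulr1.
Qed.

(** The image of Q is stable under B and E and contains the ones.  Conversely P_a
    contains b = E 1, hence all c_g by [class_vecs_min], and then everything that
    steps of B produce from them. *)
Lemma local_module_punctured_space : local_module R (box_edge e) a = punctured_space.
Proof.
have [[_ BA EA MA] _] := local_algebraP R (box_edge e) a.
set P := local_module R (box_edge e) a.
have stable M v : M \in local_algebra R (box_edge e) a -> v \in P -> M *m v \in P.
  exact: local_module_stable.
apply: subv_anti; apply/andP; split.
  apply: local_module_min; first exact: ones_punctured_space.
    exact: punctured_space_adj.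
  by move=> v /punctured_space_boundary; apply: (subvP class_span_punctured_space).
have bP : b \in P.
  have -> : b = E *m ones_vec R a.
    rewrite ones_fr forget_root_vfun nbr_diag_vfun; apply: eq_vfun => x.
    by rewrite mulr1.
  by apply: (stable _ _ EA); apply: ones_local_module.
have cP g : class_vec R e r (I g) \in P.
  apply: class_vecs_min bP _ g => k v vP.
  rewrite /return_mx -!mulmxA; apply: (stable _ _ EA).
  have := stable _ _ EA vP; elim: k (E *m v) => [|k IHk] w wP.
    by rewrite expr0 mul1mx.
  by rewrite exprSr -mulmxA; apply: IHk; apply: (stable _ _ BA wP).
apply: punctured_space_sub => c0 c p.
have pol (q : {poly R}) : fr (vfun (spectral_vec c0 (class_fun c) (horner q))) \in P.
  elim/poly_ind: q => [|q s IHq].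
    rewrite (_ : vfun _ = 0) ?linear0 ?mem0v //.
    by apply/colP => k; rewrite !mxE /spectral_vec big1 // => f _;
      rewrite horner0 mulr0.
  rewrite (_ : vfun _ = vfun (nbr_sum (box_edge e) (spectral_vec c0 (class_fun c)
    (horner q))) +
     s *: vfun (spectral_vec c0 (class_fun c) (fun=> 1))); last first.
    apply/colP => k; rewrite !mxE spectral_vec_adj /spectral_vec mulr_sumr -big_split.
    apply: eq_bigr => f _ /=; rewrite hornerD hornerM hornerX hornerC.
    by rewrite mulr1 mulrDr (mulrC _ s) (mulrC q.[_]).
  rewrite linearD linearZ /= memvD //; last first.
    by rewrite memvZ // spectral_vec_fr1 class_dir_sum memv_suml // => g _;
      rewrite memvZ.
  have := forget_root_adj a box_edge_sym (spectral_vec c0 (class_fun c) (horner q)).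
  move/eqP; rewrite eq_sym subr_eq => /eqP ->.
  by rewrite memvD ?memvZ // stable.
have [q qE] := interpolation (codom (fun f : label => lam f)) p.
rewrite (eq_vfun (h2 := spectral_vec c0 (class_fun c) (horner q))) ?pol // => x.
by apply: eq_bigr => f _; rewrite qE // (codom_f (fun f : label => lam f)).
Qed.

(** b_i is the tensor product of A_i e_(r_i) with the root vectors of the other factors. *)
Lemma dir_krylov i : dir i \in krylov_punctured R e r.
Proof.
pose w k : 'cV[R]_#|F k| :=
  if k == i then adjmx R (e k) *m basis_vec R (r k) else basis_vec R (r k).
have krylovE k m : adjmx R (e k) ^+ m *m basis_vec R (r k) \in krylov R (e k) (r k).
  by apply: mem_span_set; exists m.
have wK k : w k \in krylov R (e k) (r k).
  rewrite /w; case: ifP => _; first by have := krylovE k 1%N; rewrite expr1.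
  by have := krylovE k 0%N; rewrite expr0 mul1mx.
have wE : pure_tensor w = vfun (fun x => (box_step e i a x)%:R : R).
  apply: eq_vfun => x; rewrite (bigD1 i) //= {1}/w eqxx adjmx_vfun coord_vfun.
  rewrite /box_step ffunE -mulnb natrM; congr (_ * _).
    rewrite /nbr_sum big_mkcond (bigD1 (r i)) //= eqxx big1 ?addr0.
      by rewrite esymm; case: (e i).
    by move=> u /negPf ->; case: (e i).
  transitivity (\prod_(k | k != i) (x k == r k)%:R : R).
    by apply: eq_bigr => k /negPf ki; rewrite /w ki coord_vfun.
  case: forall_inP => [xr|nxr].
    by rewrite big1 // => k ki; rewrite -(eqP (xr k ki)) ffunE eqxx.
  have [k /andP[ki xk]] : exists k, (k != i) && (x k != r k).
    apply/existsP; apply: contra_notT nxr => /existsPn xr k ki.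
    by have := xr k; rewrite ki /= negbK ffunE eq_sym.
  by rewrite (bigD1 k) //= (negPf xk) mul0r.
have -> : dir i = linfun fr (vfun (fun x => (box_step e i a x)%:R)).
  by rewrite lfunE /= forget_root_vfun.
apply: memv_img; rewrite memv_cap -wE mem_span_set; last by exists w.
rewrite memv_ker lfunE /= wE; apply/eqP/matrixP => u v.
rewrite !ord1 vfun_dot mxE (bigD1 a) //= eqxx mul1r big1.
  by rewrite /box_step ffunE eirr addr0.
by move=> x /negPf ->; rewrite mul0r.
Qed.

Lemma boundary_return_spaceE :
  boundary_return_space (box_edge e) (krylov_punctured R e r) = class_span.
Proof.
apply: smallest_vs_eq => [|U [_ bU Uret]].
  split; [|exact: nbr_vec_span|exact: punctured_space_return].
  apply/span_subvP => _ /mapP[g _ ->]; apply: memv_suml => i _.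
  have := memv_img (linfun (mulmx E)) (dir_krylov i).
  by rewrite lfunE /= nbr_diag_dir.
by apply/span_subvP => _ /mapP[g _ ->]; apply: class_vecs_min.
Qed.

Lemma dim_local_module :
  (\dim (local_module R (box_edge e) a)).+1 =
  \big[addn/0%N]_(x \in minkowski_sum [set: 'I_t]%SET T) \rank (fiber_mx T x).
Proof.
rewrite local_module_punctured_space dim_punctured_space dim_root_space.
rewrite (fsbig_fwiden joint_values) ?undup_uniq //.
- by rewrite (big_nth 0) big_mkord.
- move=> x /minkowski_sumP[y Ty ->] /=; rewrite mem_undup.
  have /class_spectrumP[f wf yf] : forall g, T g ((\row_g y g : 'rV[R]_t) 0 g).
    by move=> g; rewrite mxE; apply: Ty; rewrite inE.
  rewrite (_ : \sum_(i in _) y i = lam f) ?(codom_f (fun f : label => lam f)) //.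
  rewrite -class_values_sum yf; apply: eq_big => [g|g _];
    [by rewrite inE | by rewrite mxE].
- move=> x [_ /= Nx]; apply/eqP; rewrite -leqn0.
  apply: leq_trans (rank_leq_row _) _; rewrite leqn0 size_eq0.
  apply/eqP; case fE: (fiber_seq T x) => [//|y s].
  have : y \in fiber_seq T x by rewrite fE mem_head.
  rewrite mem_fiber_seq => /asboolP[Ty yx]; case: Nx; apply/minkowski_sumP.
  exists (fun g => y 0 g) => [g _|]; first exact: Ty.
  by rewrite -yx; apply: eq_bigl => g; rewrite inE.
Qed.

End Assembly.

(** * The theorem *)

(** One finite family of reals containing the local spectra of all factors, so that
    labellings are plain functions on the factors. *)
Lemma common_spectrum (R : realType) (l : nat) (F : 'I_l -> finType)
    (e : forall i, rel (F i)) (r : forall i, F i) :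
  (forall i, symmetric (e i)) ->
  exists (J : finType) (th : J -> R), [/\ injective th,
    forall i u, \sum_s local_comp (e i) (r i) (th s) u = (u == r i)%:R &
    forall i x, local_spectrum R (e i) (r i) x -> exists s, th s = x].
Proof.
move=> esym.
have /fin_all_exists [rs rsP] := fun i => local_resolution R (r i) (esym i).
pose S := undup (flatten [seq rs i | i <- enum 'I_l]).
pose th (s : 'I_(size S)) : R := S`_s.
have onto i x : x \in rs i -> x \in codom th.
  move=> xi; have xS : x \in S.
    by rewrite mem_undup; apply/flattenP; exists (rs i) => //; rewrite map_f ?mem_enum.
  have xlt : (index x S < size S)%N by rewrite index_mem.
  by apply/codomP; exists (Ordinal xlt); rewrite /th nth_index.
have thI : injective th.
  by move=> s s' /eqP; rewrite nth_uniq ?undup_uniq // => /eqP/val_inj.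
exists 'I_(size S), th; split=> // [i u|i x].
  by have [_] := rsP i; apply=> // x; apply: onto.
by have [H _] := rsP i => /H/onto/codomP[s ->]; exists s.
Qed.

Theorem theorem3p2 (R : realType) (l : nat) (hl : (0 < l)%N)
  (F : 'I_l -> finType) (e : forall i, rel (F i)) (r : forall i, F i)
  (d : 'I_l -> nat)
  (hF : forall i, admissible_factor (e i) (r i) (d i))
  (t : nat) (I : 'I_t -> {set 'I_l}) (I_inj : injective I)
  (I_classes : [set I g | g : 'I_t]%SET = boundary_classes R e r d) :
  let T (g : 'I_t) : set R := class_spectrum R e r (I g) in
  let Lambda : set R := minkowski_sum [set: 'I_t]%SET T in
  [/\ boundary_return_space (box_edge e) (krylov_punctured R e r)
        = <<[seq class_vec R e r (I g) | g <- enum 'I_t]>>%VS,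
      (\dim (local_module R (box_edge e) (box_root r)))%:Z
        = (\big[addn/0%N]_(lam \in Lambda) \rank (fiber_mx T lam))%:Z - 1
    & forall (F' : 'I_l -> finType) (e' : forall i, rel (F' i))
             (r' : forall i, F' i) (d' : 'I_l -> nat),
        (forall i, admissible_factor (e' i) (r' i) (d' i)) ->
        (forall i, local_spectrum R (e' i) (r' i)
                   = local_spectrum R (e i) (r i)) ->
        (forall i theta, local_spectrum R (e i) (r i) theta ->
           local_weight R (e' i) (r' i) theta
           = local_weight R (e i) (r i) theta) ->
        \dim (local_module R (box_edge e') (box_root r'))
        = \dim (local_module R (box_edge e) (box_root r))].
Proof.
move=> T Lambda.
have esym i : symmetric (e i) by case: (hF i) => -[].
have [J [th [thI res spec]]] := common_spectrum R r esym.
have dimE := dim_local_module hF thI res spec I_inj I_classes.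
split.
- exact (boundary_return_spaceE hF thI res spec I_inj I_classes).
- by rewrite -dimE intS addrAC subrr add0r.
move=> F' e' r' d' hF' specE weightE; apply: succn_inj; rewrite dimE.
have esym' i : symmetric (e' i) by case: (hF' i) => -[].
have [J' [th' [thI' res' spec']]] := common_spectrum R r' esym'.
have PhiE i : local_Phi (e' i) (r' i) = local_Phi (e i) (r i) :> (R -> R).
  apply/funext => z; rewrite /local_Phi specE.
  by apply: eq_fsbigr => x /set_mem xi; rewrite weightE.
(* Phi determines the valency as its second derivative at 0. *)
have dE i : d' i = d i.
  apply/eqP; rewrite -(eqr_nat R) -(degree_local_Phi hF' thI' res' spec').
  by rewrite PhiE (degree_local_Phi hF thI res spec).
have classesE : boundary_classes R e' r' d' = boundary_classes R e r d.
  congr (equivalence_partition _ _).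
  apply/funext => i; apply/funext => j.
  by rewrite /local_eta !PhiE !dE.
have TE : (fun g => class_spectrum R e' r' (I g)) = T.
  apply/funext => g; rewrite /T /class_spectrum; congr minkowski_sum.
  exact/funext.
rewrite -classesE in I_classes.
by rewrite (dim_local_module hF' thI' res' spec' I_inj I_classes) TE.
Qed.
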